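(* Let $N\ge1$, $\Omega=[-1,1]^N$, let $\|\cdot\|$ be a norm on $\mathbb{R}^N$, and let $d_0(x,y)=\|x-y\|$. Let $(T_n)_{n\ge1}$ be a stationary sequence of layer maps $T:\Omega\to\Omega$ of the form $T(x)=\tanh(Wx+b)$, where $W$ is an invertible real $N\times N$ matrix, $b\in\mathbb{R}^N$, and $\tanh$ is applied componentwise; stationarity (including integrability) is understood for the induced maps $T^*$ acting on the metric space $(X,D)$ defined in the context. Then there is a number $\lambda$ such that almost surely $$\lim_{n\to\infty}\left(\sup_{x\neq y}\frac{\|T_nT_{n-1}\cdots T_1x-T_nT_{n-1}\cdots T_1y\|}{\|x-y\|}\right)^{1/n}=e^{\lambda},$$ where the supremum is over $x,y\in\Omega$ with $x\ne y$. Moreover, in case $\lambda>0$, almost surely there exist a (random) point $x\in\Omega$ and a sequence $z_i=(x_i,y_i)\in\{(x,y):x,y\in\Omega,\ x\ne y\}$ such that $z_i\to(x,x)$ and such that for any $\varepsilon>0$ there is a number $N_0$ so that for every $n>N_0$ $$\frac{\|T_n\cdots T_1x_i-T_n\cdots T_1y_i\|}{\|x_i-y_i\|}\ \ge\ e^{(\lambda-\varepsilon)n}$$ for all sufficiently large $i$ (depending on $n$).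
   Context: Let $X$ be the set of distance functions (metrics) $d$ on $\Omega$ that are bi-Lipschitz equivalent to $d_0$, i.e. there is $C>1$ with $\frac1C\|x-y\|\le d(x,y)\le C\|x-y\|$ for all $x,y\in\Omega$. The metric $D$ on $X$ is $$D(d_1,d_2)=\log\left(\max\left\{\sup_{x\ne y}\frac{d_2(x,y)}{d_1(x,y)},\ \sup_{x\ne y}\frac{d_1(x,y)}{d_2(x,y)}\right\}\right).$$ An injective layer map $T:\Omega\to\Omega$ induces $T^*:X\to X$ by $(T^*d)(x,y)=d(Tx,Ty)$, which is non-expansive for $D$. Stationary sequence (integrable ergodic cocycle): there are a probability space $(M,\mu)$, a measurable, measure-preserving, ergodic transformation $L:M\to M$, and a measurable assignment $m\mapsto T_m$ of a layer map to each $m\in M$, such that all distances involved are measurable functions of $m$ and $\int_M D(T_m^*d,d)\,d\mu(m)<\infty$ for $d\in X$ (this does not depend on $d$ by non-expansiveness). The sequence is $T_i=T_{L^{i-1}m}$, $i\ge1$, and ''almost surely'' means for $\mu$-almost every $m$. Products of maps denote composition. *)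

(* Defs.v *)
From HB Require Import structures.
From mathcomp Require Import all_boot all_order all_algebra.
From mathcomp Require Import all_classical all_reals all_analysis.
Set Implicit Arguments.
Unset Strict Implicit.
Unset Printing Implicit Defensive.
Import Order.TTheory GRing.Theory Num.Theory.
Import numFieldNormedType.Exports.
Local Open Scope classical_set_scope.
Local Open Scope ring_scope.

Definition is_norm (R : realType) (N : nat) (nrm : 'cV[R]_N -> R) : Prop :=
  [/\ forall x, nrm x = 0 -> x = 0,
      forall (a : R) x, nrm (a *: x) = `|a| * nrm x &
      forall x y, nrm (x + y) <= nrm x + nrm y].

Definition cube (R : realType) (N : nat) : set 'cV[R]_N :=
  [set x | forall i, -1 <= x i 0 <= 1].
Arguments cube : clear implicits.

Definition offdiag (R : realType) (N : nat) : set ('cV[R]_N * 'cV[R]_N) :=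
  [set z | [/\ cube R N z.1, cube R N z.2 & z.1 != z.2]].
Arguments offdiag : clear implicits.

(* A distance function on the cube is represented by a total function on
   R^N x R^N; its values off the cube are never constrained nor used. *)
Definition is_distance (R : realType) (N : nat)
    (d : 'cV[R]_N -> 'cV[R]_N -> R) : Prop :=
  [/\ forall x y, cube R N x -> cube R N y -> 0 <= d x y,
      forall x y, cube R N x -> cube R N y -> (d x y = 0 <-> x = y),
      forall x y, cube R N x -> cube R N y -> d x y = d y x &
      forall x y z, cube R N x -> cube R N y -> cube R N z ->
        d x z <= d x y + d y z].

Definition metrics (R : realType) (N : nat) (nrm : 'cV[R]_N -> R) :
    set ('cV[R]_N -> 'cV[R]_N -> R) :=
  [set d | is_distance d /\
    exists2 C : R, 1 < C &
      forall x y, cube R N x -> cube R N y ->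
        C^-1 * nrm (x - y) <= d x y <= C * nrm (x - y)].

(* On [metrics nrm] with N > 0 the two sets below are nonempty and bounded,
   so that the real-valued [sup] is the genuine supremum. *)
Definition Dmetric (R : realType) (N : nat)
    (d1 d2 : 'cV[R]_N -> 'cV[R]_N -> R) : R :=
  ln (Num.max (sup [set d2 z.1 z.2 / d1 z.1 z.2 | z in offdiag R N])
              (sup [set d1 z.1 z.2 / d2 z.1 z.2 | z in offdiag R N])).

Definition pullback_dist (R : realType) (N : nat)
    (T : 'cV[R]_N -> 'cV[R]_N) (d : 'cV[R]_N -> 'cV[R]_N -> R) :
    'cV[R]_N -> 'cV[R]_N -> R :=
  fun x y => d (T x) (T y).

Definition measure_preserving d (M : measurableType d) (R : realType)
    (mu : probability M R) (L : M -> M) : Prop :=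
  measurable_fun setT L /\
  forall A, measurable A -> mu (L @^-1` A) = mu A.

Definition ergodic d (M : measurableType d) (R : realType)
    (mu : probability M R) (L : M -> M) : Prop :=
  forall A, measurable A -> L @^-1` A = A -> mu A = 0%E \/ mu A = 1%E.

(* [layer_prod L T n m] is T_n o ... o T_1, where T_i = T (L^(i-1) m). *)
Fixpoint layer_prod (M : Type) (R : realType) (N : nat) (L : M -> M)
    (T : M -> 'cV[R]_N -> 'cV[R]_N) (n : nat) (m : M) :
    'cV[R]_N -> 'cV[R]_N :=
  if n is k.+1 then T (iter k L m) \o layer_prod L T k m else id.

(* [D] is finite and nonnegative on [metrics nrm], so integrability is the
   finiteness of the integral once measurability is known. *)
Definition stationary d (M : measurableType d) (R : realType) (N : nat)
    (nrm : 'cV[R]_N -> R) (mu : probability M R) (L : M -> M)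
    (T : M -> 'cV[R]_N -> 'cV[R]_N) : Prop :=
  [/\ measure_preserving mu L,
      ergodic mu L,
      forall x i, cube R N x -> measurable_fun setT (fun m => T m x i 0),
      forall d1 d2 n, metrics nrm d1 -> metrics nrm d2 ->
        measurable_fun setT
          (fun m => Dmetric (pullback_dist (layer_prod L T n m) d1) d2) &
      forall d1, metrics nrm d1 ->
        (\int[mu]_m (Dmetric (pullback_dist (T m) d1) d1)%:E < +oo)%E].

Definition tanh (R : realType) (x : R) : R :=
  (expR x - expR (- x)) / (expR x + expR (- x)).

Definition tanh_layer (R : realType) (N : nat) (W : 'M[R]_N) (b : 'cV[R]_N)
    (x : 'cV[R]_N) : 'cV[R]_N :=
  map_mx (@tanh R) (W *m x + b).

(* Main.v *)
(** Let [a n m = ln Lip(T_n ... T_1)], a subadditive cocycle over [L], and let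
    [lambda] be the infimum of the means of [a n / n].  A maximal-inequality
    argument bounds [a n] above by [(lambda + eta) n] almost surely.  For the
    lower bound, call [n] bad if some initial stretch of [l >= k] steps
    satisfies [a n m <= a (n - l) (L^l m) + (lambda - eps) l].  Cutting an orbit
    segment greedily along the stretches that witness badness and integrating
    shows that bad times have arbitrarily small frequency when [k] is large.
    Hence almost surely there are infinitely many times [n_i] that are good for
    all [eps = 1/(j+1)] at once (this is the Gouëzel-Karlsson refinement of
    Kingman's theorem).  Subadditivity at a good time gives the convergence of
    [a n / n].  Pairs [z_i] almost maximizing the expansion of
    [T_(n_i) ... T_1] then expand at rate at least [lambda - eps] along every
    shorter product; if [lambda > 0] their two points must approach each other,
    and compactness of the cube provides the limit point [x]. *)
Require Import Defs.
From HB Require Import structures.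
From mathcomp Require Import all_boot all_order all_algebra.
From mathcomp Require Import all_classical all_reals all_analysis.
From mathcomp Require Import measurable_realfun.
From mathcomp Require Import ring lra.
Set Implicit Arguments.
Unset Strict Implicit.
Unset Printing Implicit Defensive.
Import Order.TTheory GRing.Theory Num.Theory.
Import numFieldNormedType.Exports.
Local Open Scope classical_set_scope.
Local Open Scope ring_scope.

(** * Integrals over a measure-preserving system *)

Section real_integral.
Context {disp : measure_display} {M : measurableType disp} {R : realType}.
Variable mu : probability M R.
Local Notation L1 f := (mu.-integrable setT (EFin \o f)).
Local Notation E f := (\int[mu]_x f x).
Implicit Types f g : M -> R.

Lemma L1_measurable f : L1 f -> measurable_fun setT f.
Proof. by move=> /measurable_int /measurable_EFinP. Qed.

Lemma L1_le f g : measurable_fun setT f -> L1 g -> (forall x, `|f x| <= g x) ->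
  L1 f.
Proof.
move=> mf ig fg; apply: le_integrable ig => //; first exact/measurable_EFinP.
move=> x _ /=; rewrite lee_fin; apply: le_trans (fg x) _; exact: ler_norm.
Qed.

Lemma L1D f g : L1 f -> L1 g -> L1 (fun x => f x + g x).
Proof. by move=> i_f i_g; exact: (integrableD measurableT i_f i_g). Qed.

Lemma L1B f g : L1 f -> L1 g -> L1 (fun x => f x - g x).
Proof. by move=> i_f i_g; exact: (integrableB measurableT i_f i_g). Qed.

Lemma L1Z (r : R) f : L1 f -> L1 (fun x => r * f x).
Proof. by move=> i_f; exact: (integrableZl measurableT r i_f). Qed.

Lemma L1_cst (r : R) : L1 (fun=> r).
Proof. exact: finite_measure_integrable_cst. Qed.

Lemma L1_norm f : L1 f -> L1 (fun x => `|f x|).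
Proof. by move=> /integrable_norm. Qed.

Lemma L1_sum n (F : nat -> M -> R) : (forall i, L1 (F i)) ->
  L1 (fun x => \sum_(i < n) F i x).
Proof.
move=> iF; elim: n => [|n ih].
  by under [X in L1 X]eq_fun do rewrite big_ord0; exact: L1_cst.
by under [X in L1 X]eq_fun do rewrite big_ord_recr /=; exact: L1D.
Qed.

Lemma L1_max f g : L1 f -> L1 g -> L1 (fun x => Num.max (f x) (g x)).
Proof.
move=> i1 i2; apply: (@L1_le _ (fun x => `|f x| + `|g x|)).
- by apply: measurable_maxr; exact: L1_measurable.
- by apply: L1D; exact: L1_norm.
- move=> x; rewrite ler_norml; have := ler_norm (f x); have := ler_norm (g x).
  have := ler_norm (- f x); have := ler_norm (- g x); rewrite !normrN.
  by move=> ? ? ? ?; case: (leP (f x) (g x)) => ?; apply/andP; split; lra.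
Qed.

Lemma L1_indic (A : set M) : measurable A -> L1 (\1_A : M -> R).
Proof. by move=> mA; exact: integrable_indic. Qed.

Lemma E_indic (A : set M) : measurable A -> E (\1_A : M -> R) = fine (mu A).
Proof. by move=> mA; rewrite /Rintegral integral_indic// setIT. Qed.

Lemma E_cst (r : R) : E (fun=> r) = r.
Proof. by rewrite /Rintegral integral_cst//= probability_setT mule1. Qed.

Lemma ED f g : L1 f -> L1 g -> E (fun x => f x + g x) = E f + E g.
Proof. exact: RintegralD. Qed.

Lemma EB f g : L1 f -> L1 g -> E (fun x => f x - g x) = E f - E g.
Proof. exact: RintegralB. Qed.

Lemma EZ (r : R) f : L1 f -> E (fun x => r * f x) = r * E f.
Proof. by move=> ?; rewrite RintegralZl. Qed.

Lemma E_le f g : L1 f -> L1 g -> (forall x, f x <= g x) -> E f <= E g.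
Proof. by move=> ? ? fg; exact: le_Rintegral. Qed.

Lemma E_sum n (F : nat -> M -> R) : (forall i, L1 (F i)) ->
  E (fun x => \sum_(i < n) F i x) = \sum_(i < n) E (F i).
Proof.
move=> iF; elim: n => [|n ih].
  rewrite big_ord0; under eq_Rintegral do rewrite big_ord0; exact: E_cst.
under eq_Rintegral do rewrite big_ord_recr /=.
by rewrite ED// ?ih ?big_ord_recr//; exact: L1_sum.
Qed.

Lemma E_dominated (f_ : nat -> M -> R) f g :
  (forall n, measurable_fun setT (f_ n)) -> measurable_fun setT f -> L1 g ->
  {ae mu, forall x, f_ ^~ x @ \oo --> f x} ->
  (forall n x, `|f_ n x| <= g x) ->
  E (f_ n) @[n --> \oo] --> E f.
Proof.
move=> mf_ mf ig ff fg.
have [|||//||] := @dominated_convergence _ _ _ mu setT measurableT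
  (fun n => EFin \o f_ n) (EFin \o f) (EFin \o g).
- by move=> n; exact/measurable_EFinP.
- exact/measurable_EFinP.
- by apply: filterS ff => x fx _; apply: cvg_EFin => //; exact: nearW.
- by apply: aeW => x n _; rewrite /= lee_fin.
move=> i_f _ cv; apply: fine_cvg; rewrite fineK; first exact: cv.
exact: integrable_fin_num.
Qed.

Variable L : M -> M.
Hypothesis L_mp : measure_preserving mu L.

Lemma measurable_iter n : measurable_fun setT (iter n L).
Proof.
elim: n => [|n ih] /=; first exact: measurable_id.
by apply: (measurableT_comp L_mp.1 ih).
Qed.

Lemma measurable_preimage_iter n A : measurable A ->
  measurable (iter n L @^-1` A).
Proof. by move=> mA; rewrite -[X in measurable X]setTI; exact: measurable_iter. Qed.

Lemma mu_preimage_iter n A : measurable A -> mu (iter n L @^-1` A) = mu A.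
Proof.
move=> mA; elim: n => [//|n ih].
rewrite -ih -(L_mp.2 (iter n L @^-1` A)); last exact: measurable_preimage_iter.
by congr (mu _); apply/seteqP; split => x /=; rewrite -iterSr.
Qed.

(** Change of variables: the pushforward of [mu] under [iter n L] is [mu] itself. *)
Lemma L1_iter n f : L1 f -> L1 (fun x => f (iter n L x)).
Proof.
move=> /[dup] i_f /integrableP[/measurable_EFinP mf fy].
have mi := measurable_iter n.
apply/integrableP; split; first exact/measurable_EFinP/(measurableT_comp mf).
rewrite -(@ge0_integral_pushforward _ _ _ _ _ _ mi mu setT
  (fun y => `|(f y)%:E|)%E)//; last first.
  by apply/measurable_EFinP; exact: measurableT_comp.
by rewrite (eq_measure_integral mu)// => A mA _; exact: mu_preimage_iter.
Qed.

Lemma E_iter n f : L1 f -> E (fun x => f (iter n L x)) = E f.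
Proof.
move=> i_f; rewrite /Rintegral; congr fine.
have mi := measurable_iter n.
rewrite -(@integral_pushforward _ _ _ _ _ _ mi mu setT (EFin \o f))//.
- by apply: eq_measure_integral => A mA _; exact: mu_preimage_iter.
- exact/measurable_EFinP/L1_measurable.
- exact: L1_iter.
Qed.

End real_integral.

(** * Subadditive ergodic theorem *)

(** Starting at [0] keeps the maximum nonnegative; the index [n] itself is excluded. *)
Fixpoint running_max (M : Type) (R : realType) (c : nat -> M -> R) (n : nat)
    (x : M) : R :=
  if n is k.+1 then Num.max (running_max c k x) (c k x) else 0.

Section upper_bound.
Context {disp : measure_display} {M : measurableType disp} {R : realType}.
Variables (mu : probability M R) (L : M -> M).
Hypothesis L_mp : measure_preserving mu L.
Hypothesis L_erg : ergodic mu L.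
Local Notation L1 f := (mu.-integrable setT (EFin \o f)).
Local Notation E f := (\int[mu]_x f x).

(** [ergodic] speaks of strictly invariant sets only. The preimages of [A] under the iterates
    increase, all have measure [mu A], and their union is strictly invariant. *)
Lemma ergodic_forward_invariant (A : set M) :
  measurable A -> A `<=` L @^-1` A -> mu A = 0%E \/ mu A = 1%E.
Proof.
move=> mA AL; pose F n := iter n L @^-1` A.
have mF n : measurable (F n) by exact: (measurable_preimage_iter L_mp).
have mB : measurable (\bigcup_n F n) by exact: bigcup_measurable.
have ndF : nondecreasing_seq F.
  apply/nondecreasing_seqP => n; apply/subsetPset => x.
  rewrite /F /= => Ax; exact: (AL _ Ax).
have <- : mu (\bigcup_n F n) = mu A.
  have := @nondecreasing_cvg_mu _ _ _ mu F mF mB ndF.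
  move=> /cvg_lim <- //; apply/cvg_lim => //; apply: cvg_near_cst; apply: nearW => n /=.
  exact: (mu_preimage_iter L_mp).
apply: L_erg => //; apply/seteqP; split => x [n _]; rewrite /F /= => Ax.
  by exists n.+1 => //; rewrite /= -iterS iterSr.
by exists n => //; rewrite /preimage /= -iterSr /=; exact: AL.
Qed.

Lemma ae_iter (P : set M) n :
  {ae mu, forall x, P x} -> {ae mu, forall x, P (iter n L x)}.
Proof.
move=> [A [mA A0 PA]]; exists (iter n L @^-1` A); split.
- exact: (measurable_preimage_iter L_mp).
- by rewrite (mu_preimage_iter L_mp).
- by move=> x /= nP; apply: PA.
Qed.

Section running_max_theory.
Variable c : nat -> M -> R.

Lemma running_max_ge0 n x : 0 <= running_max c n x.
Proof. by elim: n => //= n ih; rewrite le_max ih. Qed.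

Lemma le_running_max n i x : (i < n)%N -> c i x <= running_max c n x.
Proof.
elim: n => //= n ih; rewrite ltnS leq_eqVlt => /predU1P[->|/ih h].
  by rewrite le_max lexx orbT.
by rewrite le_max h.
Qed.

Lemma running_max_le n x B : 0 <= B -> (forall i, (i < n)%N -> c i x <= B) ->
  running_max c n x <= B.
Proof.
move=> B0; elim: n => //= n ih h; rewrite ge_max h// andbT.
by apply: ih => i /ltnW; exact: h.
Qed.

Lemma L1_running_max n : (forall i, L1 (c i)) -> L1 (running_max c n).
Proof.
move=> ic; elim: n => [|n ih]; first exact: L1_cst.
exact: L1_max.
Qed.

End running_max_theory.

(* Garsia-type argument: if [c] were unbounded almost everywhere, then
   [running_max c (K + n) - running_max c n \o L^K], whose mean is nonnegative,
   would be dominated by functions converging to [c K]. *)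
Lemma subadditive_bounded (c : nat -> M -> R) (K : nat) :
  (forall n, L1 (c n)) ->
  (forall n k x, c (n + k)%N x <= c n x + c k (iter n L x)) ->
  E (c K) < 0 ->
  {ae mu, forall x, exists B : R, forall n, c n x <= B}.
Proof.
move=> ic c_sub cK0.
pose U := [set x | forall B : nat, exists n, B%:R < c n x].
have UE : U = \bigcap_B \bigcup_n [set x | (B%:R : R) < c n x].
  apply/seteqP; split => x /=.
    by move=> Ux B _; have [n ?] := Ux B; exists n.
  by move=> Ux B; have [//|n _ ?] := Ux B; exists n.
have mU : measurable U.
  rewrite UE; apply: bigcap_measurable => // B _; apply: bigcup_measurable => n _.
  rewrite -[X in measurable X]setTI; apply: measurable_fun_ltr => //.
  exact: (L1_measurable (ic n)).
have UL : U `<=` L @^-1` U.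
  move=> x Ux B /=.
  (* The term with [c 0] rules out [n = 0], and the term with [c 1] pays for the first step. *)
  have [n Bn] := Ux (Num.truncn (`|c 0%N x| + `|c 1%N x| + B%:R)).+1.
  have h : `|c 0%N x| + `|c 1%N x| + B%:R < c n x.
    by apply: lt_trans Bn; exact: truncnS_gt.
  case: n {Bn} h => [|n] h.
    by have := ler_norm (c 0%N x); have := normr_ge0 (c 1%N x);
      have : 0 <= B%:R :> R by []; lra.
  exists n; have := c_sub 1%N n x; rewrite add1n /= => ?.
  by have := ler_norm (c 1%N x); have := normr_ge0 (c 0%N x); lra.
have [U0|U1] := ergodic_forward_invariant mU UL.
  exists U; split => // x /= nB; apply: contrapT => nU; apply: nB.
  move: nU; rewrite /U /= => /existsNP[B /forallNP hB]; exists B%:R => n.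
  by rewrite leNgt; apply/negP; exact: hB.
exfalso; have aeU : {ae mu, forall x, U x}.
  exists (~` U); split => //; first exact: measurableC.
  by rewrite probability_setC// U1 subee.
have {aeU}aeUK := ae_iter K aeU.
pose h n x := Num.max (running_max c K x - running_max c n (iter K L x)) (c K x).
have iM n := L1_running_max n ic.
have ih n : L1 (h n).
  by apply: L1_max => //; apply: L1B => //; exact: (L1_iter L_mp).
(* Subadditivity at [K] bounds the difference of running maxima by [h n]. The mean of that
   difference is nonnegative because [L] preserves [mu] and the running maximum grows with its
   index. *)
have h_ge0 n : 0 <= E (h n).
  have : E (fun x => running_max c (K + n) x - running_max c n (iter K L x))
         <= E (h n).
    apply: E_le => //; first by apply: L1B => //; exact: (L1_iter L_mp).
    move=> x; rewrite /h lerBlDr; set m := running_max c n _.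
    have leh y : (y <= running_max c K x) || (y <= c K x + m) ->
        y <= Num.max (running_max c K x - m) (c K x) + m.
      by move=> hy; rewrite -lerBlDr le_max lerD2r lerBlDr.
    have m0 : 0 <= m by exact: running_max_ge0.
    have MK0 := running_max_ge0 c K x.
    apply: running_max_le => [|i ilt]; first by rewrite leh// MK0.
    case: (ltnP i K) => iK; first by rewrite leh// le_running_max.
    rewrite leh//; apply/orP; right; rewrite -(subnKC iK).
    apply: le_trans (c_sub _ _ _) _; rewrite lerD2l.
    by apply: le_running_max; rewrite ltn_subLR.
  apply: le_trans; rewrite EB//; last exact: (L1_iter L_mp).
  rewrite (E_iter L_mp)// subr_ge0; apply: E_le => // x.
  apply: running_max_le; first exact: running_max_ge0.
  by move=> i ilt; apply: le_running_max; rewrite (leq_trans ilt)// leq_addl.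
have : E (h n) @[n --> \oo] --> E (c K).
  apply: (@E_dominated _ _ _ mu h (c K) (fun x => `|running_max c K x| + `|c K x|)).
  - by move=> n; exact: L1_measurable (ih n).
  - exact: L1_measurable (ic K).
  - by apply: L1D; exact: L1_norm.
  (* Once the running maximum along the orbit of [L^K x] is large, [c K x] wins and [h n x] is
     constant in [n]. *)
  - apply: filterS aeUK => x UK.
    have [n Bn] := UK (Num.truncn (running_max c K x - c K x)).+1.
    apply: cvg_near_cst; exists n.+1 => //= k /= nk; rewrite /h max_r//.
    rewrite lerBlDl -lerBlDr; apply: le_trans (le_running_max c _ nk).
    exact: le_trans (ltW (truncnS_gt _)) (ltW Bn).
  - move=> n x; rewrite /h ler_norml.
    have m0 := running_max_ge0 c n (iter K L x).
    have MK0 := running_max_ge0 c K x.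
    rewrite (ger0_norm MK0); have := ler_norm (c K x).
    have := ler_norm (- c K x); rewrite normrN => ? ?.
    by case: (leP (running_max c K x - running_max c n (iter K L x)) (c K x))
      => ?; apply/andP; split; lra.
move=> cv; suff : 0 <= E (c K) by rewrite leNgt cK0.
rewrite -(cvg_lim _ cv)//; apply: limr_ge; first by apply/cvg_ex; exists (E (c K)).
exact: nearW.
Qed.

End upper_bound.

(** * Growth rate, frequency of bad times, and the refined subadditive theorem *)

Section subadditive_ergodic.
Context {disp : measure_display} {M : measurableType disp} {R : realType}.
Variables (mu : probability M R) (L : M -> M).
Hypothesis L_mp : measure_preserving mu L.
Hypothesis L_erg : ergodic mu L.
Local Notation L1 f := (mu.-integrable setT (EFin \o f)).
Local Notation E f := (\int[mu]_x f x).
Variables (a : nat -> M -> R) (q : M -> R).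
Hypothesis a_meas : forall n, measurable_fun setT (a n).
Hypothesis q_int : L1 q.
Hypothesis a_le : forall n x, `|a n x| <= \sum_(i < n) q (iter i L x).
Hypothesis a_sub : forall n k x, a (n + k)%N x <= a n x + a k (iter n L x).

Lemma cocycle_integrable n : L1 (a n).
Proof.
apply: (L1_le (a_meas n) _ (a_le n)).
exact: (L1_sum n (fun i => L1_iter L_mp i q_int)).
Qed.

Lemma cocycle0 x : a 0%N x = 0.
Proof. by apply/eqP; have := a_le 0%N x; rewrite big_ord0 normr_le0. Qed.

Lemma mean_cocycle_ge n : - (E q * n%:R) <= E (a n).
Proof.
have -> : - (E q * n%:R) = E (fun x => (-1) * \sum_(i < n) q (iter i L x)).
  rewrite EZ; last exact: (L1_sum n (fun i => L1_iter L_mp i q_int)).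
  rewrite (E_sum n (fun i => L1_iter L_mp i q_int)).
  under eq_bigr do rewrite (E_iter L_mp)//.
  by rewrite sumr_const card_ord mulN1r mulr_natr.
apply: E_le; [|exact: cocycle_integrable|].
  by apply: L1Z; exact: (L1_sum n (fun i => L1_iter L_mp i q_int)).
by move=> x; rewrite mulN1r lerNl (le_trans _ (a_le n x))// -normrN ler_norm.
Qed.

(** The index [n.+1] avoids division by zero. The infimum is genuine: [mean_cocycle_ge] bounds the
    set below by [- E q]. *)
Definition growth : R := inf [set E (a n.+1) / n.+1%:R | n in setT].
Local Notation lam := growth.

Lemma growth_le n : lam * n%:R <= E (a n).
Proof.
case: n => [|n].
  by rewrite mulr0 (_ : a 0%N = fun=> 0) ?E_cst//; apply/funext => x; exact: cocycle0.
rewrite -ler_pdivlMr// /growth; apply: ge_inf; last by exists n.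
exists (- E q) => _ [k _ <-]; rewrite ler_pdivlMr// mulNr; exact: mean_cocycle_ge.
Qed.

Lemma growth_lt (eta : R) : 0 < eta -> exists n, E (a n) < (lam + eta) * n%:R.
Proof.
move=> eta0; have [|_ [n _ <-] h] := @inf_adherent _
    [set E (a n.+1) / n.+1%:R | n in setT] _ eta0.
  split; first by exists (E (a 1%N) / 1%:R); exists 0%N.
  exists (- E q) => _ [k _ <-]; rewrite ler_pdivlMr// mulNr; exact: mean_cocycle_ge.
by exists n.+1; rewrite -ltr_pdivrMr.
Qed.

(** [subadditive_bounded] applies to [a n - (lam + eta / 2) * n], whose mean is negative at some
    [K]; the spare [eta / 2 * n] eventually exceeds the resulting bound. *)
Lemma ae_upper (eta : R) : 0 < eta ->
  {ae mu, forall x, \forall n \near \oo, a n x <= (lam + eta) * n%:R}.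
Proof.
move=> eta0; have e20 : 0 < eta / 2 by rewrite divr_gt0.
have [K aK] := growth_lt e20.
pose c n x := a n x - (lam + eta / 2) * n%:R.
have := @subadditive_bounded _ _ _ mu L L_mp L_erg c K.
case.
- by move=> n; apply: L1B; [exact: cocycle_integrable|exact: L1_cst].
- move=> n k x; rewrite /c natrD; have := a_sub n k x; lra.
- by rewrite EB ?E_cst ?subr_lt0//; [exact: cocycle_integrable|exact: L1_cst].
move=> A [mA A0 cA]; exists A; split => //; apply: subset_trans cA => x /= nP hB.
apply: nP; have [B cB] := hB; exists (Num.truncn (`|B| / (eta / 2))).+1 => //= n /= hn.
have := cB n; rewrite /c => {}cB.
have : B <= eta / 2 * n%:R.
  rewrite mulrC -ler_pdivrMr//; apply: le_trans (_ : `|B| / (eta / 2) <= _).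
    by rewrite ler_pM2r ?invr_gt0// ler_norm.
  apply: le_trans (ltW (truncnS_gt _)) _; by rewrite ler_nat.
lra.
Qed.

(* Bad times [n] for [x]: the first [l] of the [n] steps, for some [l >= k],
   contribute less than [(lam - eps) l] to [a n x]. *)
Definition bad (eps : R) (k n : nat) : set M :=
  [set x | exists l, [/\ (k <= l)%N, (l <= n)%N &
    a n x <= a (n - l)%N (iter l L x) + (lam - eps) * l%:R]].

Lemma measurable_bad eps k n : measurable (bad eps k n).
Proof.
rewrite (_ : bad _ _ _ = \bigcup_(l in [set l | (k <= l <= n)%N])
   [set x | a n x <= a (n - l)%N (iter l L x) + (lam - eps) * l%:R]).
  apply: bigcup_measurable => l _; rewrite -[X in measurable X]setTI.
  apply: measurable_fun_ler => //; apply: measurable_funD => //.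
  by apply: measurableT_comp => //; exact: (measurable_iter L_mp).
apply/seteqP; split=> x [l]; first by case=> h1 h2 h3; exists l => //=; rewrite h1.
by move=> /andP[h1 h2] h3; exists l.
Qed.

Lemma bad_small eps k n : (n < k)%N -> bad eps k n = set0.
Proof.
move=> nk; rewrite -subset0 => x [l [h1 h2 _]].
by have := leq_ltn_trans (leq_trans h1 h2) nk; rewrite ltnn.
Qed.

(* The orbit segment of length [n] is cut greedily: jump over a stretch
   witnessing a weakly bad point, otherwise make [K] steps at once from a nice
   point, otherwise make a single step. *)
Lemma covering_bound (eta eps C : R) (K k : nat) (v w : M -> R) :
  0 <= eta -> 0 < eps -> (0 < K)%N -> (0 < k)%N ->
  C + (`|lam| + eps) * K%:R <= eps / 2 * k%:R ->
  (forall x, 0 <= v x) -> (forall x, `|a 1%N x| + `|lam| <= w x) ->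
  (forall x, a K x <= (lam + eta) * K%:R /\ running_max a K x <= C \/
             w x <= v x) ->
  forall n x, a n x <= \sum_(i < n) (lam + eta
     - eps / 2 * \1_(bad eps k (n - i)) (iter i L x)
     + v (iter i L x) + (if (n - i < K)%N then w (iter i L x) else 0)).
Proof.
move=> eta0 eps0 K0 k0 hk v0 aw nice; set F := fun (m : nat) (y : M) => lam + eta
  - eps / 2 * \1_(bad eps k m) y + v y + (if (m < K)%N then w y else 0).
have w0 y : 0 <= w y.
  by apply: le_trans (aw y); rewrite addr_ge0.
have i1 m y : 0 <= (\1_(bad eps k m) y : R) <= 1.
  by rewrite indicE; case: (_ \in _); rewrite ?lexx ?ler01.
have wK m y : 0 <= (if (m < K)%N then w y else 0) by case: ifP.
(* Enough to pay for each step of a stretch that witnesses weak badness, i.e. badness with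
   [eps / 2]. *)
have Fge m y : lam - eps / 2 <= F m y.
  rewrite /F; have /andP[_ h] := i1 m y.
  have : eps / 2 * \1_(bad eps k m) y <= eps / 2 * 1.
    by rewrite ler_pM2l// divr_gt0.
  by have := v0 y; have := wK m y; lra.
have Fge' m y : ~ bad eps k m y ->
    lam + eta + v y + (if (m < K)%N then w y else 0) <= F m y.
  by move=> nb; rewrite /F indicE memNset// mulr0 subr0.
suff H n : forall x, a n x <= \sum_(i < n) F (n - i)%N (iter i L x) by [].
elim/ltn_ind: n => n ih x.
(* By strong induction, only the first [j] steps have to be paid for by their own summands. *)
have step j : (0 < j <= n)%N ->
    a n x <= \sum_(i < j) F (n - i)%N (iter i L x) + a (n - j)%N (iter j L x) ->
    a n x <= \sum_(i < n) F (n - i)%N (iter i L x).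
  move=> /andP[j0 jn] /le_trans; apply.
  have [m nE] : exists m, n = (j + m)%N by exists (n - j)%N; rewrite subnKC.
  subst n; rewrite big_split_ord /= lerD2l addKn.
  apply: le_trans (ih m _ _) _; first by rewrite -[X in (X < _)%N]add0n ltn_add2r.
  by apply: ler_sum => i _; rewrite subnDl -iterD addnC.
have [n0|n0] := posnP n; first by rewrite n0 big_ord0 cocycle0.
(* Testing with [eps / 2] is the weaker condition: when it fails, badness with [eps] fails as well
   and the indicator at [x] vanishes. *)
have [[l [kl ln bl]]|nb] := pselect (bad (eps / 2) k n x).
  apply: (step l); first by rewrite (leq_trans k0 kl).
  apply: (le_trans bl); rewrite addrC lerD2r.
  rewrite mulr_natr -[l in X in X <= _]card_ord -sumr_const.
  by apply: ler_sum => i _; exact: Fge.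
have nb0 : ~ bad eps k n x.
  move=> [l [kl ln bl]]; apply: nb; exists l; split => //; apply: (le_trans bl).
  by rewrite lerD2l ler_wpM2r// lerB// ler_pdivrMr// ler_pMr// ler1n.
(* A single step is affordable where [w x] is covered by [v x] or, with fewer than [K] steps left,
   by the last term. *)
have single : w x <= v x + (if (n < K)%N then w x else 0) ->
    a n x <= \sum_(i < n) F (n - i)%N (iter i L x).
  move=> hw; apply: (step 1%N) => //; rewrite big_ord1 /= subn0.
  have := a_sub 1 (n - 1) x; rewrite subnKC//= => h1.
  have := Fge' n x nb0; have := aw x; have := ler_norm (a 1%N x).
  have := ler_norm (- lam); rewrite normrN; lra.
have [nK|Kn] := ltnP n K; first by apply: single; rewrite nK lerDr.
have [[aK rK]|wv] := nice x; last first.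
  by apply: single; apply: (le_trans wv); rewrite lerDl.
apply: (step K); first by rewrite K0.
have := a_sub K (n - K) x; rewrite subnKC// => /le_trans; apply.
rewrite lerD2r; apply: (le_trans aK); rewrite mulr_natr.
rewrite -[K in X in X <= _]card_ord -sumr_const; apply: ler_sum => i _.
(* Otherwise the [i] steps from [x] followed by the witnessing stretch would be weakly bad at [x]:
   the first [i] steps cost at most [C], and the slack [eps / 2 * l] absorbs this since [l >= k]. *)
have nbi : ~ bad eps k (n - i) (iter i L x).
  move=> [l [kl ln bl]]; apply: nb; exists (i + l)%N; split.
  - exact: leq_trans kl (leq_addl _ _).
  - by move: ln; rewrite leq_subRL// ltnW// (leq_trans _ Kn).
  have iK : (i%:R : R) <= K%:R by rewrite ler_nat ltnW.
  have kl' : (k%:R : R) <= l%:R by rewrite ler_nat.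
  have := a_sub i (n - i) x; rewrite subnKC; last by rewrite ltnW// (leq_trans _ Kn).
  move=> h1; have := le_trans (le_running_max a x (ltn_ord i)) rK => h2.
  rewrite addnC iterD [(l + i)%N]addnC subnDA natrD.
  have h3 : (eps / 2 - lam) * i%:R <= (`|lam| + eps) * K%:R.
    apply: le_trans (_ : (`|lam| + eps) * i%:R <= _).
      rewrite ler_wpM2r//; have := ler_norm (- lam); rewrite normrN; lra.
    by rewrite ler_wpM2l// addr_ge0// ltW.
  have h4 : eps / 2 * k%:R <= eps / 2 * l%:R by rewrite ler_pM2l// divr_gt0.
  by move: bl; rewrite !mulrBl; lra.
apply: le_trans (Fge' _ _ nbi); have := v0 (iter i L x); have := wK (n - i)%N (iter i L x).
by lra.
Qed.

(** Dominated convergence, with [|w|] as the dominating function. *)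
Lemma E_indic_small (D : nat -> set M) (w : M -> R) (e : R) :
  (forall n, measurable (D n)) -> L1 w -> 0 < e ->
  {ae mu, forall x, \forall n \near \oo, ~ D n x} ->
  \forall n \near \oo, E (fun x => `|w x| * \1_(D n) x) < e.
Proof.
move=> mD iw e0 aeD.
have : E (fun x => `|w x| * \1_(D n) x) @[n --> \oo] --> E (fun=> 0 : R).
  apply: (@E_dominated _ _ _ mu _ _ (fun x => `|w x|)).
  - move=> n; apply: measurable_funM; first exact: (L1_measurable (L1_norm iw)).
    exact: measurable_indic.
  - exact: measurable_cst.
  - exact: L1_norm.
  - apply: filterS aeD => x Dx; apply: cvg_near_cst.
    by apply: filterS Dx => n nD; rewrite indicE memNset// mulr0.
  - move=> n x; rewrite normrM normr_id indicE ger0_norm//.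
    by case: (_ \in _); rewrite ?mulr1 ?mulr0.
rewrite E_cst => /cvgr_lt; exact.
Qed.

(** Integrate [covering_bound]: by [growth_le] the terms [lam * n] cancel, and [eps / 2] times the
    sum of the measures is bounded by the error terms. *)
Lemma average_bad (eps del : R) : 0 < eps -> 0 < del ->
  exists k0, forall k, (k0 <= k)%N -> forall n,
    \sum_(i < n) fine (mu (bad eps k i.+1)) <= del * n%:R.
Proof.
(* The errors will add up to at most [4 * eta * n], within the allowed
   [eps / 2 * del * n = 8 * eta * n]. *)
move=> eps0 del0; pose eta := eps * del / 16.
have eta0 : 0 < eta by rewrite /eta divr_gt0// mulr_gt0.
pose w x := `|a 1%N x| + `|lam|.
have iw : L1 w by apply: L1D; [exact: L1_norm (cocycle_integrable 1)|exact: L1_cst].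
have w0 x : 0 <= w x by rewrite addr_ge0.
pose D n := [set x | (lam + eta) * n%:R < a n x].
have mD n : measurable (D n).
  by rewrite -[X in measurable X]setTI; apply: measurable_fun_ltr.
(* By [ae_upper], for large [K] little of the integral of [w] sits where [a K] exceeds
   [(lam + eta) * K]. *)
have [K [K0 EK]] : exists K, (0 < K)%N /\ E (fun x => `|w x| * \1_(D K) x) < eta.
  have h : {ae mu, forall x, \forall n \near \oo, ~ D n x}.
    by apply: filterS (ae_upper eta0) => x; apply: filterS => n; rewrite /D /= leNgt => /negP.
  have [N _ hN] := E_indic_small mD iw eta0 h.
  by exists N.+1; split => //; apply: hN => /=.
pose D' n := [set x | n%:R < running_max a K x].
have mD' n : measurable (D' n).
  rewrite -[X in measurable X]setTI; apply: measurable_fun_ltr => //.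
  exact: (L1_measurable (L1_running_max K cocycle_integrable)).
have [C EC] : exists C, E (fun x => `|w x| * \1_(D' C) x) < eta.
  have h : {ae mu, forall x, \forall n \near \oo, ~ D' n x}.
    apply: aeW => x; exists (Num.truncn (running_max a K x)).+1 => // n /= hn.
    apply/negP; rewrite -leNgt; apply: le_trans (ltW (truncnS_gt _)) _.
    by rewrite ler_nat.
  have [N _ hN] := E_indic_small mD' iw eta0 h.
  by exists N; apply: hN => /=.
pose v x := `|w x| * \1_(D K) x + `|w x| * \1_(D' C) x.
have iwD A : measurable A -> L1 (fun x => `|w x| * \1_A x).
  move=> mA; apply: (L1_le _ (L1_norm iw)).
    apply: measurable_funM; first exact: (L1_measurable (L1_norm iw)).
    exact: measurable_indic.
  move=> x; rewrite normrM normr_id indicE ger0_norm//.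
  by case: (_ \in _); rewrite ?mulr1 ?mulr0.
have iv : L1 v by apply: L1D; apply: iwD.
have Ev : E v <= 2 * eta by rewrite ED//; [lra|exact: iwD|exact: iwD].
(* The first term secures the hypothesis of [covering_bound] on [k]; the second makes the boundary
   cost [K * E w] at most [eta * k]. *)
pose B := (C%:R + (`|lam| + eps) * K%:R) / (eps / 2) + K%:R * E w / eta.
exists (Num.truncn B).+1 => k hk n.
have hB : B <= k%:R.
  by apply: le_trans (ltW (truncnS_gt _)) _; rewrite ler_nat.
have Ew : 0 <= E w by apply: Rintegral_ge0.
have p1 : 0 <= (C%:R + (`|lam| + eps) * K%:R) / (eps / 2).
  by rewrite divr_ge0 ?addr_ge0 ?mulr_ge0 ?addr_ge0// ?ltW// divr_gt0.
have p2 : 0 <= K%:R * E w / eta by rewrite divr_ge0 ?mulr_ge0// ltW.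
have k1 : C%:R + (`|lam| + eps) * K%:R <= eps / 2 * k%:R.
  by rewrite [leRHS]mulrC -ler_pdivrMr ?divr_gt0//; move: hB; rewrite /B; lra.
have k2 : K%:R * E w <= eta * k%:R.
  by rewrite [leRHS]mulrC -ler_pdivrMr//; move: hB; rewrite /B; lra.
(* No time up to [n] can be bad when [n < k], so the main case has [k <= n]. *)
have [nk|kn] := ltnP n k.
  rewrite big1 => [|i _]; first by rewrite mulr_ge0// ltW.
  by rewrite bad_small ?measure0// (leq_ltn_trans _ nk).
have k0 : (0 < k)%N by apply: leq_trans hk.
have v0 x : 0 <= v x by rewrite addr_ge0// mulr_ge0.
have nice x : a K x <= (lam + eta) * K%:R /\ running_max a K x <= C%:R \/ w x <= v x.
  have [Dx|nDx] := pselect (D K x).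
    right; rewrite /v [\1_(D K) x]indicE mem_set// mulr1 ger0_norm// lerDl mulr_ge0//.
  have [Dx'|nDx'] := pselect (D' C x).
    right; rewrite /v [\1_(D' C) x]indicE mem_set// mulr1 ger0_norm// lerDr mulr_ge0//.
  left; split; rewrite leNgt; exact/negP.
have cov := covering_bound (ltW eta0) eps0 K0 k0 k1 v0 (fun x => lexx (w x)) nice n.
have ind i := L1_indic mu (measurable_bad eps k (n - i)).
have indi i := L1_iter L_mp i (ind i).
have ib i : L1 (fun x => eps / 2 * \1_(bad eps k (n - i)) (iter i L x)).
  exact: (L1Z (eps / 2) (indi i)).
have ivi i := L1_iter L_mp i iv.
have iwi i := L1_iter L_mp i iw.
have iif (c : bool) i : L1 (fun x => if c then w (iter i L x) else 0).
  by case: c; [exact: iwi|exact: L1_cst].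
pose F i x := lam + eta
     - eps / 2 * \1_(bad eps k (n - i)) (iter i L x)
     + v (iter i L x) + (if (n - i < K)%N then w (iter i L x) else 0).
have iF i : L1 (F i).
  apply: L1D (iif _ _); apply: L1D (ivi _); apply: L1B (ib _); exact: L1_cst.
have EF i : E (F i) = lam + eta - eps / 2 * fine (mu (bad eps k (n - i)))
    + E v + (if (n - i < K)%N then E w else 0).
  rewrite /F ED//; last by apply: L1D (ivi _); apply: L1B (ib _); exact: L1_cst.
  rewrite ED//; last by apply: L1B (ib _); exact: L1_cst.
  rewrite EB ?E_cst//; last exact: L1_cst.
  rewrite (E_iter L_mp)//; congr (_ - _ + _ + _).
    rewrite (EZ (eps / 2) (indi i)) (E_iter L_mp i (ind i)) E_indic//.
    exact: measurable_bad.
  by case: ifP => _; [rewrite (E_iter L_mp)|rewrite E_cst].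
have := E_le (cocycle_integrable n) (L1_sum n iF) cov.
rewrite (E_sum n iF); under eq_bigr do rewrite EF.
rewrite big_split /= big_split /= sumrB !sumr_const card_ord -mulr_sumr.
rewrite -[(lam + eta) *+ n]mulr_natr -[(\int[mu]_x v x) *+ n]mulr_natr.
(* Reversing the order turns the remaining length [n - i] into the time [i.+1]. *)
have -> : \sum_(i < n) fine (mu (bad eps k (n - i))) =
    \sum_(i < n) fine (mu (bad eps k i.+1)).
  rewrite (reindex_inj rev_ord_inj) /=; apply: eq_bigr => i _.
  by rewrite subnA// ?subnn// subKn.
set S := \sum_(i < n) fine _.
(* At most [K] positions have fewer than [K] steps left. *)
have : \sum_(i < n) (if (n - i < K)%N then E w else 0) <= K%:R * E w.
  rewrite (reindex_inj rev_ord_inj) /=.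
  have cnt m : \sum_(i < m) (if (i < K)%N then E w else 0) = (minn m K)%:R * E w.
    elim: m => [|m ih]; first by rewrite big_ord0 min0n mul0r.
    rewrite big_ord_recr /= ih; case: (ltnP m K) => mK.
      by rewrite (minn_idPl mK) -[in RHS]addn1 natrD mulrDl mul1r.
    by rewrite (minn_idPr (leqW mK)) addr0.
  apply: (@le_trans _ _ ((minn n K)%:R * E w)).
    rewrite -cnt; apply: ler_sum => i _; rewrite subKn//.
    by case: ltnP => [/ltnW->//|_]; case: ifP.
  by rewrite ler_wpM2r// ler_nat geq_minr.
have := growth_le n.
have nk : eta * k%:R <= eta * n%:R by rewrite ler_pM2l// ler_nat.
have Evn : E v * n%:R <= 2 * eta * n%:R by rewrite ler_wpM2r.
move=> g1 g2 g3.
have : eps / 2 * S <= eps / 2 * (del * n%:R).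
  have -> : eps / 2 * (del * n%:R) = 8 * eta * n%:R by rewrite /eta; field.
  have : 0 <= eta * n%:R by rewrite mulr_ge0// ltW.
  move: g3; rewrite mulrDl; lra.
by rewrite ler_pM2l// divr_gt0.
Qed.

(* For each [p] the thresholds [kk p j] give [B p n], the set where [n] is bad
   for some [j], a mean measure at most [1 / (p + 1)] over any initial segment
   of times; hence being bad at all late times has measure at most
   [2 / (p + 1)]. *)
Lemma ae_good_times : {ae mu, forall x, exists kk : nat -> nat,
  forall n0, exists2 n, (n0 <= n)%N & forall j, ~ bad j.+1%:R^-1 (kk j) n x}.
Proof.
(* Geometric weights in [j], with total at most [1 / (p + 1)]. *)
pose del (p j : nat) : R := p.+1%:R^-1 * 2^-1 ^+ j.+1.
have /choice[k0 hk0] : forall pj : nat * nat, exists k0, forall k, (k0 <= k)%N ->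
    forall n, \sum_(i < n) fine (mu (bad pj.2.+1%:R^-1 k i.+1))
      <= del pj.1 pj.2 * n%:R.
  move=> [p j]; apply: average_bad; first by rewrite invr_gt0.
  by rewrite mulr_gt0 ?exprn_gt0 ?invr_gt0.
(* [j < kk p j] makes [B p n] below a finite union. *)
pose kk p j := maxn (k0 (p, j)) j.+1.
pose B p n := \bigcup_j bad j.+1%:R^-1 (kk p j) n.
have mB p n : measurable (B p n).
  by apply: bigcup_measurable => j _; exact: measurable_bad.
have B_le p n J : (n <= J)%N ->
    fine (mu (B p n)) <= \sum_(j < J) fine (mu (bad j.+1%:R^-1 (kk p j) n)).
  move=> nJ; have ib (j : nat) := L1_indic mu (measurable_bad j.+1%:R^-1 (kk p j) n).
  have -> : \sum_(j < J) fine (mu (bad j.+1%:R^-1 (kk p j) n)) =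
      \sum_(j < J) E (\1_(bad j.+1%:R^-1 (kk p j) n) : M -> R).
    by apply: eq_bigr => j _; rewrite E_indic//; exact: measurable_bad.
  rewrite -E_indic// -(E_sum J ib).
  apply: E_le (L1_sum J ib) _; first exact: L1_indic.
  move=> x; rewrite indicE; case: (boolP (_ \in _)) => [|_]; last first.
    by apply: sumr_ge0 => i _; rewrite indicE.
  rewrite inE => -[j _ bj]; have jJ : (j < J)%N.
    rewrite ltnNge; apply/negP => Jj; move: bj; rewrite bad_small//.
    by rewrite (leq_ltn_trans (leq_trans nJ Jj))// leq_maxr.
  rewrite (bigD1 (Ordinal jJ))//= indicE mem_set// lerDl.
  by apply: sumr_ge0 => i _; rewrite indicE.
have sum_del p J : \sum_(j < J) del p j <= p.+1%:R^-1.
  have -> : \sum_(j < J) del p j = p.+1%:R^-1 * (1 - 2^-1 ^+ J).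
    elim: J => [|J ih]; first by rewrite big_ord0 expr0 subrr mulr0.
    by rewrite big_ord_recr /= ih /del exprS; field; rewrite addrC natr1 pnatr_eq0.
  by rewrite ler_piMr// gerBl exprn_ge0.
pose Z p n0 := \bigcap_(n in [set n | (n0 <= n)%N]) B p n.
have mZ p n0 : measurable (Z p n0).
  by apply: bigcap_measurableType => n _; exact: mB.
have fine_mu_le (A A' : set M) : measurable A -> measurable A' -> A `<=` A' ->
    fine (mu A) <= fine (mu A').
  by move=> mA mA' AA'; rewrite fine_le ?fin_num_measure// le_measure ?inE.
have Z_le p n0 : fine (mu (Z p n0)) <= 2 * p.+1%:R^-1.
  set c := fine _; have hc i : (n0 <= i)%N -> c <= fine (mu (B p i.+1)).
    by move=> ni; apply: fine_mu_le => // x; apply; rewrite /= leqW.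
  (* Half of these [N] times surely lie beyond [n0], whence the factor [2] in the bound. *)
  pose N := (n0.+1 + n0.+1)%N.
  have h1 : \sum_(i < N) fine (mu (B p i.+1)) <= p.+1%:R^-1 * N%:R.
    apply: (@le_trans _ _ (\sum_(i < N) \sum_(j < N)
        fine (mu (bad j.+1%:R^-1 (kk p j) i.+1)))).
      by apply: ler_sum => i _; apply: B_le.
    rewrite exchange_big /=; apply: le_trans (_ : \sum_(j < N) del p j * N%:R <= _).
      by apply: ler_sum => j _; apply: (hk0 (p, nat_of_ord j)); rewrite leq_maxl.
    by rewrite -mulr_suml ler_wpM2r.
  have h2 : c * n0.+1%:R <= \sum_(i < N) fine (mu (B p i.+1)).
    rewrite big_split_ord /= -[leLHS]add0r; apply: lerD.
      by apply: sumr_ge0 => i _; exact: fine_ge0.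
    rewrite mulr_natr -[X in _ *+ X]card_ord -sumr_const; apply: ler_sum => i _.
    by apply: hc; exact: leq_trans (leqnSn n0) (leq_addr _ _).
  have := le_trans h2 h1.
  have -> : p.+1%:R^-1 * N%:R = 2 * p.+1%:R^-1 * n0.+1%:R :> R.
    by rewrite /N natrD; ring.
  by rewrite ler_pM2r// ltr0n.
pose U p := \bigcup_n0 Z p n0.
have mU p : measurable (U p) by exact: bigcup_measurable.
have U_le p : fine (mu (U p)) <= 2 * p.+1%:R^-1.
  have ndZ : nondecreasing_seq (Z p).
    apply/nondecreasing_seqP => n; apply/subsetPset => x Zx m /= nm.
    by apply: Zx; exact: ltnW.
  have cv := @nondecreasing_cvg_mu _ _ _ mu (Z p) (mZ p) (mU p) ndZ.
  rewrite -lee_fin fineK ?fin_num_measure// -(cvg_lim _ cv)//.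
  apply: lime_le; first by apply/cvg_ex; exists (mu (U p)).
  by apply: nearW => n; rewrite /= -[mu _]fineK ?fin_num_measure// lee_fin.
(* The exceptional points fail for every [p], so their set has measure at most [2 / (p + 1)] for all
   [p]. *)
exists (\bigcap_p U p); split.
- exact: bigcap_measurableType.
- have mI : measurable (\bigcap_p U p) by exact: bigcap_measurableType.
  rewrite -[mu _]fineK ?fin_num_measure//; congr EFin; apply/eqP.
  rewrite eq_le fine_ge0// andbT leNgt; apply/negP; set c := fine _ => c0.
  pose p := Num.truncn (2 / c).
  have : c <= 2 * p.+1%:R^-1.
    by apply: le_trans (U_le p); apply: fine_mu_le => // x; apply.
  rewrite leNgt ltr_pdivrMr// mulrC -ltr_pdivrMr// truncnS_gt//.
- move=> x nx p _; apply: contrapT => nU; apply: nx; exists (kk p) => n0.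
  apply: contrapT => h; apply: nU; exists n0 => // n /= n0n.
  apply: contrapT => nB; apply: h; exists n => // j bj; apply: nB.
  by exists j.
Qed.

(** Both clauses hold with [growth]; the second says that badness fails at the good times, with
    thresholds [kk j] depending on the point. *)
Theorem subadditive_ergodic : exists lambda : R,
  {ae mu, forall x, (fun n => a n x / n%:R) @ \oo --> lambda} /\
  {ae mu, forall x, exists kk : nat -> nat, forall n0, exists2 n, (n0 <= n)%N &
    forall j l, (kk j <= l <= n)%N ->
      (lambda - j.+1%:R^-1) * l%:R <= a n x - a (n - l)%N (iter l L x)}.
Proof.
exists lam; split; last first.
  apply: filterS ae_good_times => x [kk hkk]; exists kk => n0.
  have [n n0n nb] := hkk n0; exists n => // j l /andP[kl ln].
  rewrite lerBrDr addrC leNgt; apply/negP => h; apply: (nb j); exists l; split => //.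
  exact: ltW.
have up : {ae mu, forall x, forall j : nat,
    \forall n \near \oo, a n x <= (lam + j.+1%:R^-1) * n%:R}.
  by apply: ae_foralln => j; apply: ae_upper; rewrite invr_gt0.
have low := ae_good_times.
apply: filterS2 up low => x up [kk hkk].
apply/cvgrPdist_le => e e0; pose j := Num.truncn e^-1.
have je : j.+1%:R^-1 <= e.
  by rewrite -[leRHS]invrK lef_pV2 ?posrE ?invr_gt0// ltW// truncnS_gt.
have [N1 _ hN1] := up j; exists (maxn N1 (kk j).+1) => // n /=.
rewrite geq_max => /andP[/hN1 /= h1 kn].
have n0 : 0 < n%:R :> R by rewrite ltr0n (leq_ltn_trans _ kn).
rewrite ler_distlC; apply/andP; split.
  (* If [a n x] were too small, subadditivity at a good time [m >= n] would make [l = n] a witness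
     that [m] is bad. *)
  rewrite ler_pdivlMr//; have [m nm nb] := hkk n.
  have h2 : (lam - j.+1%:R^-1) * n%:R <= a n x.
    have := a_sub n (m - n) x; rewrite subnKC// => h2.
    rewrite leNgt; apply/negP => h3; apply: (nb j); exists n; split => //.
      exact: ltnW.
    by rewrite (le_trans h2)// addrC lerD2l ltW.
  by apply: le_trans h2; rewrite ler_pM2r// lerB.
by rewrite ler_pdivrMr// (le_trans h1)// ler_pM2r// lerD2l.
Qed.

End subadditive_ergodic.

(** * Norms and layer maps *)

Section norm_on_columns.
Context {R : realType} {N : nat}.
Variable nrm : 'cV[R]_N -> R.
Hypothesis nrm_norm : is_norm nrm.

Lemma nrm0 : nrm 0 = 0.
Proof. by case: nrm_norm => _ nZ _; rewrite -(scale0r 0) nZ normr0 mul0r. Qed.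

Lemma nrmN x : nrm (- x) = nrm x.
Proof. by case: nrm_norm => _ nZ _; rewrite -scaleN1r nZ normrN1 mul1r. Qed.

Lemma nrmBC x y : nrm (x - y) = nrm (y - x).
Proof. by rewrite -nrmN opprB. Qed.

Lemma nrm_ge0 x : 0 <= nrm x.
Proof.
case: nrm_norm => _ _ nD; have := nD x (- x).
by rewrite subrr nrm0 nrmN; lra.
Qed.

Lemma nrm_eq0 x : (nrm x == 0) = (x == 0).
Proof.
case: nrm_norm => n0 _ _; apply/eqP/eqP => [/n0//|->]; exact: nrm0.
Qed.

Lemma nrm_gt0 x : (0 < nrm x) = (x != 0).
Proof. by rewrite lt_neqAle nrm_ge0 andbT eq_sym nrm_eq0. Qed.

Lemma nrm_sum n (F : 'I_n -> 'cV[R]_N) : nrm (\sum_i F i) <= \sum_i nrm (F i).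
Proof.
elim: n F => [|n ih] F; first by rewrite !big_ord0 nrm0.
rewrite !big_ord_recr /=; case: nrm_norm => _ _ nD.
by apply: le_trans (nD _ _) _; rewrite lerD2r; exact: ih.
Qed.

End norm_on_columns.

Lemma coord_le_norm {R : realType} {m n : nat} (x : 'M[R]_(m, n)) i j :
  `|x i j| <= `|x|.
Proof.
rewrite [leRHS]mx_normrE.
by apply: (le_trans _ (le_bigmax _ _ (i, j))).
Qed.

Lemma norm_le_coord {R : realType} {m n : nat} (x : 'M[R]_(m, n)) (B : R) :
  0 <= B -> (forall i j, `|x i j| <= B) -> `|x| <= B.
Proof.
move=> B0 xB; rewrite [leLHS]mx_normrE.
by apply: bigmax_le => // -[i j] _.
Qed.

Lemma norm_mulmx_le {R : realType} {m n : nat} (A : 'M[R]_(m, n)) :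
  exists2 C : R, 0 < C & forall x : 'cV[R]_n, `|A *m x| <= C * `|x|.
Proof.
exists (n%:R * `|A| + 1) => [|x]; first by rewrite ltr_wpDl// mulr_ge0.
apply: norm_le_coord => [|i j]; first by rewrite mulr_ge0// addr_ge0// mulr_ge0.
rewrite mxE; apply: le_trans (ler_norm_sum _ _ _) _.
apply: le_trans (_ : \sum_(k < n) `|A| * `|x| <= _).
  by apply: ler_sum => k _; rewrite normrM ler_pM// coord_le_norm.
rewrite sumr_const card_ord -[leLHS]mulr_natl mulrA.
by rewrite ler_wpM2r// lerDl.
Qed.

(** * Equivalence of the given norm with the max norm *)

Section norm_equivalence.
Context {R : realType} {N : nat}.
Variable nrm : 'cV[R]_N -> R.
Hypothesis nrm_norm : is_norm nrm.

Lemma nrm_le_norm : exists2 C : R, 0 < C & forall x, nrm x <= C * `|x|.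
Proof.
exists (\sum_(i < N) nrm (delta_mx i 0) + 1) => [|x].
  by rewrite ltr_wpDl// sumr_ge0// => i _; exact: nrm_ge0.
have {1}-> : x = \sum_i x i 0 *: delta_mx i 0.
  rewrite {1}[x]matrix_sum_delta; apply: eq_bigr => i _.
  by rewrite big_ord1.
apply: le_trans (nrm_sum nrm_norm _) _; rewrite mulrDl mul1r.
apply: ler_wpDr => //; rewrite mulr_suml; apply: ler_sum => i _.
case: nrm_norm => _ -> _; rewrite mulrC ler_wpM2l ?nrm_ge0//.
exact: coord_le_norm.
Qed.

(** The constant is the inverse of the minimum of [nrm] on the unit sphere of the max norm, attained
    by compactness. Row vectors are used so that [bounded_closed_compact] applies. *)
Lemma norm_le_nrm : exists2 C : R, 0 < C & forall x, `|x| <= C * nrm x.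
Proof.
have [C C0 nC] := nrm_le_norm.
pose f (x : 'rV[R]_N) := nrm x^T.
pose S := [set x : 'rV[R]_N | `|x| = 1].
have normT (x : 'cV[R]_N) : `|x^T| = `|x|.
  apply/eqP; rewrite eq_le; apply/andP; split; apply: norm_le_coord => // i j.
    by rewrite mxE coord_le_norm.
  by have -> : x i j = x^T j i; [rewrite mxE|exact: coord_le_norm].
have cf : continuous f.
  move=> x; apply/(@cvgrPdist_lt _ _ _ (nbhs x) (nbhs_filter x)) => e e0.
  apply/nbhs_ballP; exists (e / C) => [|y]; first by rewrite /= divr_gt0.
  rewrite mx_norm_ball /ball_ /= => xy.
  apply: (@le_lt_trans _ _ (C * `|x - y|)).
    have -> : `|x - y| = `|(x - y)^T| by rewrite -normT trmxK.
    apply: le_trans (nC _); rewrite /f linearB /=.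
    case: nrm_norm => _ _ nD; rewrite ler_norml; apply/andP; split.
      have := nD (y^T - x^T) x^T; rewrite subrK (nrmBC nrm_norm); lra.
    have := nD (x^T - y^T) y^T; rewrite subrK; lra.
  by rewrite mulrC -ltr_pdivlMr.
have cS : compact S.
  apply: bounded_closed_compact.
    by exists 1; split => // r r1 x /= ->; exact: ltW.
  rewrite (_ : S = (fun x => `|x|) @^-1` [set 1]) //.
  apply: closed_comp; last exact: closed_eq.
  by move=> x _; exact: norm_continuous.
(* The sphere is empty only if every vector is zero. *)
have [S0|/set0P S0] := eqVneq S set0.
  exists 1 => // x; suff -> : x = 0 by rewrite normr0 (nrm0 nrm_norm) mulr0.
  apply/eqP; apply: contrapT => /negP x0; have : set0 x^T; last by [].
  have : S (`|x|^-1 *: x^T); last by rewrite S0.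
  by rewrite /S /= normrZ normT ger0_norm ?invr_ge0// mulVf// normr_eq0.
have [c cS' cmin] := compact_EVT_min S0 cS (continuous_subspaceT cf).
have fc0 : 0 < f c.
  rewrite /f nrm_gt0//; apply/eqP => cT; move: cS'; rewrite inE /S /=.
  by rewrite -[c]trmxK cT trmx0 normr0 => /eqP; rewrite eq_sym oner_eq0.
exists (f c)^-1 => [|x]; first by rewrite invr_gt0.
have [->|x0] := eqVneq x 0; first by rewrite normr0 (nrm0 nrm_norm) mulr0.
have nx0 : 0 < `|x| by rewrite normr_gt0.
have := cmin (`|x|^-1 *: x^T); rewrite inE => /(_ _)/wrap[].
  by rewrite /S /= normrZ normT ger0_norm ?invr_ge0// mulVf// gt_eqF.
rewrite {2}/f linearZ /= trmxK; case: nrm_norm => _ -> _.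
rewrite ger0_norm ?invr_ge0// => h.
by rewrite ler_pdivlMl// mulrC -ler_pdivlMl.
Qed.

End norm_equivalence.

(** * Bilipschitz bounds for the hyperbolic tangent *)

Lemma tanh_le1 {R : realType} (u : R) : -1 <= tanh u <= 1.
Proof.
have a0 := expR_gt0 u; have b0 := expR_gt0 (- u).
have s0 : 0 < expR u + expR (- u) by rewrite addr_gt0.
by rewrite /tanh ler_pdivlMr// ler_pdivrMr//; apply/andP; split; lra.
Qed.

(** This is [sinh (u - v) / (cosh u * cosh v)] written with exponentials. *)
Lemma tanhB {R : realType} (u v : R) : tanh u - tanh v =
  2 * (expR (u - v) - expR (v - u)) /
  ((expR u + expR (- u)) * (expR v + expR (- v))).
Proof.
rewrite !expRD /tanh !expRN; have := expR_gt0 u; have := expR_gt0 v.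
move: (expR u) (expR v) => s t t0 s0; field.
have t1 : 0 < t ^+ 2 + 1 by rewrite ltr_wpDl// sqr_ge0.
have s1 : 0 < s ^+ 2 + 1 by rewrite ltr_wpDl// sqr_ge0.
by do ?[apply/andP; split]; rewrite ?gt_eqF.
Qed.

(** In [tanhB] the denominator lies between [1] and [4 * expR B ^ 2], and [t = u - v >= 0] satisfies
    [t <= expR t - expR (- t) <= 2 * t * expR t] with [t <= 2 * B]. *)
Lemma tanh_bilipschitz {R : realType} (B : R) : exists2 c : R, 0 < c &
  forall u v, `|u| <= B -> `|v| <= B ->
    `|u - v| <= c * `|tanh u - tanh v| /\ `|tanh u - tanh v| <= c * `|u - v|.
Proof.
exists (4 * expR B * expR B) => [|]; first by rewrite !mulr_gt0// expR_gt0.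
move=> u v; wlog uv : u v / v <= u.
  move=> H uB vB; have [|/ltW] := leP v u; first by move=> h; exact: H.
  by move=> h; rewrite distrC [`|tanh u - _|]distrC; exact: H.
move=> uB vB; have /andP[u1 u2] : - B <= u <= B by rewrite -ler_norml.
have /andP[v1 v2] : - B <= v <= B by rewrite -ler_norml.
have eB (x : R) : - B <= x -> x <= B -> 1 <= expR x + expR (- x) <= 2 * expR B.
  move=> x1 x2; apply/andP; split.
    have := expR_ge1Dx x; have := expR_ge1Dx (- x).
    have := expR_gt0 x; have := expR_gt0 (- x); lra.
  have : expR x <= expR B by rewrite ler_expR.
  have : expR (- x) <= expR B by rewrite ler_expR lerNl.
  lra.
have /andP[p1 p2] := eB u u1 u2; have /andP[q1 q2] := eB v v1 v2.
set P := expR u + expR (- u) in p1 p2 *; set Q := expR v + expR (- v) in q1 q2 *.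
have tE := tanhB u v; rewrite -/P -/Q in tE.
set t := u - v; have t0 : 0 <= t by rewrite subr_ge0.
have vuE : v - u = - t by rewrite opprB.
rewrite -/t vuE in tE.
have PQ1 : 1 <= P * Q by rewrite -[1]mulr1 ler_pM.
have PQ2 : P * Q <= 4 * expR B * expR B.
  rewrite (_ : 4 * expR B * expR B = (2 * expR B) * (2 * expR B)); last by ring.
  by apply: ler_pM => //; [apply: le_trans p1|apply: le_trans q1].
have PQ0 : 0 < P * Q by apply: lt_le_trans PQ1.
have e1 : t <= expR t - expR (- t).
  have := expR_ge1Dx t; have : expR (- t) <= 1 by rewrite expR_le1 oppr_le0.
  lra.
have e2 : expR t - expR (- t) <= 2 * t * expR t.
  have := expR_ge1Dx (- t *+ 2); rewrite mulr2n expRD => h.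
  have := expR_gt0 t => h'.
  have -> : expR t - expR (- t) = (1 - expR (- t) * expR (- t)) * expR t.
    rewrite expRN; field; exact: lt0r_neq0.
  by rewrite ler_pM2r//; lra.
have e3 : expR t * 1 <= expR B * expR B.
  by rewrite mulr1 -expRD ler_expR /t; lra.
have n0 : 0 <= 2 * (expR t - expR (- t)) by lra.
have d0 : 0 <= tanh u - tanh v by rewrite tE divr_ge0// ltW.
have b0 : 0 < 4 * expR B * expR B by rewrite !mulr_gt0// expR_gt0.
rewrite (ger0_norm t0) (ger0_norm d0) tE; split.
  rewrite mulrA ler_pdivlMr//.
  have h1 : t * (P * Q) <= t * (4 * expR B * expR B) by rewrite ler_wpM2l.
  have h2 : t <= 2 * (expR t - expR (- t)) by lra.
  by apply: (le_trans h1); rewrite [t * _]mulrC ler_wpM2l// ltW.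
have h2 : t * expR t <= t * (expR B * expR B) by rewrite ler_wpM2l// -[expR t]mulr1.
have h3 : 4 * expR B * expR B * t * 1 <= 4 * expR B * expR B * t * (P * Q).
  by rewrite ler_wpM2l// mulr_ge0// ltW.
by rewrite ler_pdivrMr//; lra.
Qed.

(** * Lipschitz constants of bilipschitz maps and the metric [D] *)

Section lipschitz_constants.
Context {R : realType} {N : nat}.
Hypothesis N_ge1 : (1 <= N)%N.
Variable nrm : 'cV[R]_N -> R.
Hypothesis nrm_norm : is_norm nrm.
Implicit Types (S : 'cV[R]_N -> 'cV[R]_N) (z : 'cV[R]_N * 'cV[R]_N).

Definition bilipschitz S : Prop :=
  (forall x, cube R N x -> cube R N (S x)) /\
  exists2 c : R, 0 < c & forall x y, cube R N x -> cube R N y ->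
    nrm (x - y) <= c * nrm (S x - S y) /\ nrm (S x - S y) <= c * nrm (x - y).

Definition Lip S : R :=
  sup [set nrm (S z.1 - S z.2) / nrm (z.1 - z.2) | z in offdiag R N].

(** For bilipschitz [S], the Lipschitz constant of its inverse on the image of the cube. *)
Definition coLip S : R :=
  sup [set nrm (z.1 - z.2) / nrm (S z.1 - S z.2) | z in offdiag R N].

Lemma bilipschitz_id : bilipschitz id.
Proof. by split => //; exists 1 => // x y _ _; rewrite mul1r. Qed.

Lemma bilipschitz_comp S1 S2 :
  bilipschitz S2 -> bilipschitz S1 -> bilipschitz (S2 \o S1).
Proof.
move=> [S2c [c2 c20 h2]] [S1c [c1 c10 h1]]; split; first by move=> x /S1c /S2c.
exists (c1 * c2) => [|x y cx cy]; first exact: mulr_gt0.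
have [h11 h12] := h1 _ _ cx cy; have [h21 h22] := h2 _ _ (S1c _ cx) (S1c _ cy).
split; first by apply: (le_trans h11); rewrite -mulrA ler_pM2l.
by apply: (le_trans h22); rewrite mulrAC [leRHS]mulrC ler_pM2l.
Qed.

Lemma cube_norm_le1 (x : 'cV[R]_N) : cube R N x -> `|x| <= 1.
Proof.
by move=> cx; apply: norm_le_coord => // i j; rewrite ord1 ler_norml; exact: cx.
Qed.

(** On the cube the coordinates of [W *m x + b] stay bounded, so [tanh] is bilipschitz there;
    [invmx W] gives the lower bound for the linear part. *)
Lemma bilipschitz_tanh_layer (W : 'M[R]_N) (b : 'cV[R]_N) :
  W \in unitmx -> bilipschitz (tanh_layer W b).
Proof.
move=> uW; split; first by move=> x _ i; rewrite !mxE tanh_le1.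
have [w w0 hW] := norm_mulmx_le W; have [w' w'0 hW'] := norm_mulmx_le (invmx W).
have [p p0 hp] := nrm_le_norm nrm_norm; have [p' p'0 hp'] := norm_le_nrm nrm_norm.
have [c c0 hc] := tanh_bilipschitz (w + `|b|).
have coord x i : cube R N x -> `|(W *m x + b) i 0| <= w + `|b|.
  move=> cx; apply: le_trans (coord_le_norm _ _ _) _.
  apply: le_trans (ler_normD _ _) _; rewrite lerD2r.
  by apply: le_trans (hW _) _; rewrite ler_piMr ?cube_norm_le1// ltW.
have main x y : cube R N x -> cube R N y ->
    `|W *m x - W *m y| <= c * `|tanh_layer W b x - tanh_layer W b y| /\
    `|tanh_layer W b x - tanh_layer W b y| <= c * `|W *m x - W *m y|.
  move=> cx cy; have tE i : (W *m x - W *m y) i 0 =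
      (W *m x + b) i 0 - (W *m y + b) i 0 by rewrite !mxE; ring.
  split; (apply: norm_le_coord; first by rewrite mulr_ge0// ltW) => i j;
    rewrite [j]ord1; have [h1 h2] := hc _ _ (coord x i cx) (coord y i cy).
    rewrite tE; apply: (le_trans h1); rewrite ler_pM2l//.
    by have := coord_le_norm (tanh_layer W b x - tanh_layer W b y) i 0; rewrite !mxE.
  have -> : (tanh_layer W b x - tanh_layer W b y) i 0 =
      tanh ((W *m x + b) i 0) - tanh ((W *m y + b) i 0) by rewrite !mxE.
  by apply: (le_trans h2); rewrite ler_pM2l// -tE coord_le_norm.
(* The sum [w' + w] serves both directions: [w'] bounds [invmx W] and [w] bounds [W]. *)
exists (p * (w' + w) * c * p') => [|x y cx cy].
  by rewrite !mulr_gt0// addr_gt0.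
have [h1 h2] := main x y cx cy; rewrite -mulmxBr in h1 h2.
have nT := hp' (tanh_layer W b x - tanh_layer W b y).
have nx := hp' (x - y); have nW := hW (x - y).
have nW' := hW' (W *m (x - y)); rewrite mulKmx// in nW'.
split.
  apply: le_trans (hp _) _; rewrite -!mulrA ler_pM2l//.
  apply: (le_trans nW'); apply: ler_pM => //; [exact: ltW|by rewrite lerDl ltW|].
  by apply: (le_trans h1); rewrite ler_pM2l.
apply: le_trans (hp _) _; rewrite -!mulrA ler_pM2l//.
apply: (le_trans h2); rewrite [leRHS]mulrCA ler_pM2l//.
apply: (le_trans nW); apply: ler_pM => //; first exact: ltW.
by rewrite lerDr ltW.
Qed.

Lemma offdiag_neq0 : offdiag R N !=set0.
Proof.
exists (const_mx 1, const_mx 0); split => /=.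
- by move=> i; rewrite mxE; apply/andP; split; lra.
- by move=> i; rewrite mxE; apply/andP; split; lra.
- apply/eqP => /matrixP /(_ (Ordinal N_ge1) 0); rewrite !mxE.
  by move/eqP; rewrite oner_eq0.
Qed.

Lemma offdiag_gt0 z : offdiag R N z -> 0 < nrm (z.1 - z.2).
Proof. by move=> [_ _ z12]; rewrite nrm_gt0// subr_eq0. Qed.

Section one_map.
Variable S : 'cV[R]_N -> 'cV[R]_N.
Hypothesis S_bilip : bilipschitz S.

Lemma bilipschitz_offdiag z : offdiag R N z -> offdiag R N (S z.1, S z.2).
Proof.
move=> oz; have [c1 c2 _] := oz; have [Sc [c c0 hc]] := S_bilip.
split => /=; [exact: Sc|exact: Sc|].
have [h _] := hc _ _ c1 c2; rewrite -subr_eq0 -(nrm_gt0 nrm_norm).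
by rewrite -(pmulr_rgt0 _ c0); apply: lt_le_trans h; exact: offdiag_gt0.
Qed.

Lemma bilipschitz_gt0 z : offdiag R N z -> 0 < nrm (S z.1 - S z.2).
Proof. by move=> /bilipschitz_offdiag /offdiag_gt0. Qed.

Lemma has_sup_ratio :
  has_sup [set nrm (S z.1 - S z.2) / nrm (z.1 - z.2) | z in offdiag R N].
Proof.
split; first exact: image_nonempty offdiag_neq0.
have [_ [c c0 hc]] := S_bilip; exists c => _ [z oz <-].
rewrite ler_pdivrMr ?offdiag_gt0//; have [c1 c2 _] := oz.
by have [] := hc _ _ c1 c2.
Qed.

Lemma has_sup_coratio :
  has_sup [set nrm (z.1 - z.2) / nrm (S z.1 - S z.2) | z in offdiag R N].
Proof.
split; first exact: image_nonempty offdiag_neq0.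
have [_ [c c0 hc]] := S_bilip; exists c => _ [z oz <-].
rewrite ler_pdivrMr ?bilipschitz_gt0//; have [c1 c2 _] := oz.
by have [] := hc _ _ c1 c2.
Qed.

Lemma ratio_le_Lip z : offdiag R N z ->
  nrm (S z.1 - S z.2) / nrm (z.1 - z.2) <= Lip S.
Proof. by move=> oz; apply: ub_le_sup; [case: has_sup_ratio|exists z]. Qed.

Lemma ratio_le_coLip z : offdiag R N z ->
  nrm (z.1 - z.2) / nrm (S z.1 - S z.2) <= coLip S.
Proof. by move=> oz; apply: ub_le_sup; [case: has_sup_coratio|exists z]. Qed.

Lemma Lip_gt0 : 0 < Lip S.
Proof.
have [z oz] := offdiag_neq0; apply: lt_le_trans (ratio_le_Lip oz).
by rewrite divr_gt0 ?bilipschitz_gt0 ?offdiag_gt0.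
Qed.

Lemma coLip_gt0 : 0 < coLip S.
Proof.
have [z oz] := offdiag_neq0; apply: lt_le_trans (ratio_le_coLip oz).
by rewrite divr_gt0 ?bilipschitz_gt0 ?offdiag_gt0.
Qed.

(** The two ratios of any single pair are reciprocal. *)
Lemma Lip_coLip_ge1 : 1 <= Lip S * coLip S.
Proof.
have [z oz] := offdiag_neq0.
have z0 := offdiag_gt0 oz; have Sz0 := bilipschitz_gt0 oz.
have <- : nrm (S z.1 - S z.2) / nrm (z.1 - z.2) *
    (nrm (z.1 - z.2) / nrm (S z.1 - S z.2)) = 1.
  by field; rewrite !gt_eqF.
by rewrite ler_pM ?ratio_le_Lip ?ratio_le_coLip// divr_ge0// ltW.
Qed.

Lemma Lip_approx (t : R) : t < Lip S ->
  exists2 z, offdiag R N z & t < nrm (S z.1 - S z.2) / nrm (z.1 - z.2).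
Proof.
move=> /(sup_gt (proj1 has_sup_ratio))[_ [z oz <-] h].
by exists z.
Qed.

(* The scaling factor [e] separates the two suprema: for small [e] the maximum
   is attained by [Lip S]. *)
Lemma Dmetric_pullback (e : R) : 0 < e ->
  Dmetric (pullback_dist S (fun x y => nrm (x - y)))
          (fun x y => e * nrm (x - y)) =
  ln (Num.max (e * coLip S) (e^-1 * Lip S)).
Proof.
have supZ (e' : R) (F : _ -> R) : 0 < e' -> has_sup [set F z | z in offdiag R N] ->
    sup [set e' * F z | z in offdiag R N] = e' * sup [set F z | z in offdiag R N].
  move=> e0 hF; apply/eqP; rewrite eq_le; apply/andP; split.
    apply: ge_sup => [|_ [z oz <-]]; first exact: image_nonempty offdiag_neq0.
    by rewrite ler_pM2l//; apply: ub_le_sup; [case: hF|exists z].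
  rewrite -ler_pdivlMl//; apply: ge_sup => [|_ [z oz <-]].
    exact: image_nonempty offdiag_neq0.
  rewrite ler_pdivlMl//; apply: ub_le_sup; last by exists z.
  case: hF => _ [B hB]; exists (e' * B) => _ [y oy <-]; rewrite ler_pM2l//.
  by apply: hB; exists y.
move=> e0; rewrite /Dmetric /pullback_dist; congr (ln (Num.max _ _)).
  rewrite -supZ//; last exact: has_sup_coratio.
  by congr sup; apply: eq_imagel => z _; rewrite mulrA.
rewrite -supZ ?invr_gt0//; last exact: has_sup_ratio.
by congr sup; apply: eq_imagel => z _; rewrite invfM mulrCA mulrA.
Qed.

End one_map.

Lemma Lip_comp S1 S2 : bilipschitz S1 -> bilipschitz S2 ->
  Lip (S2 \o S1) <= Lip S2 * Lip S1.
Proof.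
move=> b1 b2; apply: ge_sup => [|_ [z oz <-]].
  exact: image_nonempty offdiag_neq0.
have oz1 := bilipschitz_offdiag b1 oz.
have h2 := ratio_le_Lip b2 oz1; have h1 := ratio_le_Lip b1 oz.
have z0 := offdiag_gt0 oz; have z10 := bilipschitz_gt0 b1 oz.
apply: le_trans (ler_pM _ _ h2 h1); rewrite ?divr_ge0 ?nrm_ge0//=.
by rewrite [leRHS]mulrA divfK// gt_eqF.
Qed.

Lemma coLip_comp S1 S2 : bilipschitz S1 -> bilipschitz S2 ->
  coLip (S2 \o S1) <= coLip S2 * coLip S1.
Proof.
move=> b1 b2; apply: ge_sup => [|_ [z oz <-]].
  exact: image_nonempty offdiag_neq0.
have oz1 := bilipschitz_offdiag b1 oz.
have h2 := ratio_le_coLip b2 oz1; have h1 := ratio_le_coLip b1 oz.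
have z0 := bilipschitz_gt0 b2 oz1; have z10 := bilipschitz_gt0 b1 oz.
apply: le_trans (ler_pM _ _ h2 h1); rewrite ?divr_ge0 ?nrm_ge0//=.
by rewrite [leRHS]mulrC [leRHS]mulrA divfK// gt_eqF.
Qed.

Definition logLip S : R := ln (Lip S).

(** For bilipschitz [S], the distance [D] between the pullback of [d0] by [S] and [d0]; see
    [Dmetric_norm]. *)
Definition distortion S : R := ln (Num.max (coLip S) (Lip S)).

Lemma max_Lip_gt0 S : bilipschitz S -> 0 < Num.max (coLip S) (Lip S).
Proof. by move=> b; rewrite lt_max Lip_gt0// orbT. Qed.

Lemma logLip_comp S1 S2 : bilipschitz S1 -> bilipschitz S2 ->
  logLip (S2 \o S1) <= logLip S1 + logLip S2.
Proof.
move=> b1 b2; have p1 := Lip_gt0 b1; have p2 := Lip_gt0 b2.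
have p := Lip_gt0 (bilipschitz_comp b2 b1).
rewrite /logLip addrC -lnM ?posrE// ler_ln ?posrE ?mulr_gt0//.
exact: Lip_comp.
Qed.

Lemma distortion_comp S1 S2 : bilipschitz S1 -> bilipschitz S2 ->
  distortion (S2 \o S1) <= distortion S1 + distortion S2.
Proof.
move=> b1 b2; have p1 := max_Lip_gt0 b1; have p2 := max_Lip_gt0 b2.
have p := max_Lip_gt0 (bilipschitz_comp b2 b1).
rewrite /distortion addrC -lnM ?posrE// ler_ln ?posrE ?mulr_gt0//.
rewrite ge_max; apply/andP; split.
  apply: le_trans (coLip_comp b1 b2) _.
  by apply: ler_pM; [exact: ltW (coLip_gt0 b2)|exact: ltW (coLip_gt0 b1)|..];
    rewrite le_max lexx.
apply: le_trans (Lip_comp b1 b2) _.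
by apply: ler_pM; [exact: ltW (Lip_gt0 b2)|exact: ltW (Lip_gt0 b1)|..];
  rewrite le_max lexx orbT.
Qed.

Lemma distortion_id : distortion id <= 0.
Proof.
have p := max_Lip_gt0 bilipschitz_id.
rewrite /distortion -ln1 ler_ln ?posrE// ge_max.
by apply/andP; split; apply: ge_sup => [|_ [z oz <-]];
  do ?[exact: image_nonempty offdiag_neq0|rewrite divff// gt_eqF// offdiag_gt0].
Qed.

(** The lower bound [- ln (coLip S) <= ln (Lip S)] is [Lip_coLip_ge1]. This supplies the integrable
    domination of the cocycle. *)
Lemma logLip_le_distortion S : bilipschitz S -> `|logLip S| <= distortion S.
Proof.
move=> b; have p := max_Lip_gt0 b; have p1 := Lip_gt0 b; have p2 := coLip_gt0 b.
rewrite ler_norml lerNl; apply/andP; split.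
  rewrite /logLip -lnV ?posrE// ler_ln ?posrE ?invr_gt0//.
  rewrite le_max; apply/orP; left; rewrite -[leLHS]mul1r ler_pdivrMr// mulrC.
  exact: Lip_coLip_ge1.
by rewrite ler_ln ?posrE// le_max lexx orbT.
Qed.

Lemma Dmetric_norm S : bilipschitz S ->
  Dmetric (pullback_dist S (fun x y => nrm (x - y))) (fun x y => nrm (x - y)) =
  distortion S.
Proof.
move=> b; have := Dmetric_pullback b ltr01; rewrite invr1 !mul1r.
suff -> : (fun x y => 1 * nrm (x - y)) = (fun x y => nrm (x - y)) by [].
by apply/funext => x; apply/funext => y; rewrite mul1r.
Qed.

(** Serves to make [logLip] measurable, since stationarity only provides measurability of [D].
    Shrinking the second metric makes the maximum select [Lip S], and the added logarithm undoes the
    scaling; the sequence is eventually constant. *)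
Lemma logLip_Dmetric_cvg S : bilipschitz S ->
  (fun j : nat => Dmetric (pullback_dist S (fun x y => nrm (x - y)))
    (fun x y => j.+1%:R^-1 * nrm (x - y)) + ln j.+1%:R^-1) @ \oo --> logLip S.
Proof.
move=> b; have p1 := Lip_gt0 b; have p2 := coLip_gt0 b.
apply: cvg_near_cst; exists (Num.truncn (coLip S / Lip S)) => // j /= hj.
have e0 : 0 < j.+1%:R^-1 :> R by rewrite invr_gt0.
rewrite (Dmetric_pullback b e0) max_r.
  by rewrite -lnM ?posrE ?mulr_gt0 ?invr_gt0// invrK mulrC mulrA mulVf ?mul1r.
rewrite invrK; apply: (@le_trans _ _ (Lip S)).
  rewrite ler_pdivrMl// -ler_pdivrMr//; apply: le_trans (ltW (truncnS_gt _)) _.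
  by rewrite ler_nat.
by rewrite ler_peMl ?ler1n// ltW.
Qed.

Lemma metrics_scaled_norm (e : R) : 0 < e ->
  metrics nrm (fun x y => e * nrm (x - y)).
Proof.
move=> e0; split.
  split=> [x y _ _|x y _ _|x y _ _|x y z _ _ _].
  - by rewrite mulr_ge0 ?nrm_ge0// ltW.
  - split=> [/eqP|->]; last by rewrite subrr (nrm0 nrm_norm) mulr0.
    by rewrite mulf_eq0 gt_eqF//= (nrm_eq0 nrm_norm) subr_eq0 => /eqP.
  - by rewrite (nrmBC nrm_norm).
  - rewrite -mulrDr ler_pM2l//; case: nrm_norm => _ _ nD.
    by apply: le_trans (nD _ _); rewrite addrA subrK.
have i0 : 0 < e^-1 by rewrite invr_gt0.
(* The sum exceeds [1] and dominates both [e] and its inverse. *)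
exists (1 + e + e^-1) => [|x y _ _]; first lra.
have C0 : 0 < 1 + e + e^-1 by lra.
apply/andP; split; rewrite ler_wpM2r ?nrm_ge0//; last lra.
by rewrite -[leRHS]invrK lef_pV2 ?posrE//; lra.
Qed.

End lipschitz_constants.

(** * Expanding pairs *)

Section subsequences.
Context {R : realType} {N : nat}.

Lemma cvg_of_bound (u : nat -> 'cV[R]_N) (x : 'cV[R]_N) (K : R) :
  (\forall k \near \oo, `|x - u k| <= K / k.+1%:R) -> u @ \oo --> x.
Proof.
move=> [k0 _ hk]; apply/cvgrPdist_lt => e e0.
exists (maxn k0 (Num.truncn (`|K| / e)).+1) => // k /=.
rewrite geq_max => /andP[/hk /= h kK]; apply: (le_lt_trans h).
rewrite ltr_pdivrMr// mulrC -ltr_pdivrMr//.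
apply: le_lt_trans (_ : `|K| / e < _); first by rewrite ler_pM2r ?invr_gt0// ler_norm.
by apply: lt_le_trans (truncnS_gt _) _; rewrite ler_nat ltnW.
Qed.

(** A cluster point exists by compactness of the cube, in row form. The indices [s k] need not
    increase: [k <= s k] suffices to transfer eventual bounds. *)
Lemma cube_subsequence (u : nat -> 'cV[R]_N) : (forall i, cube R N (u i)) ->
  exists x (s : nat -> nat), [/\ cube R N x, forall k, (k <= s k)%N &
    forall k, `|x - u (s k)| <= k.+1%:R^-1].
Proof.
move=> cu; have cA : compact [set v : 'rV[R]_N | forall i, `[-1, 1]%classic (v ord0 i)].
  by apply: (@rV_compact R N (fun=> `[-1, 1]%classic)) => _; exact: segment_compact.
have [|v [Av clv]] := cA ((fun i => (u i)^T) @ \oo) _.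
  by exists 0%N => // i _ j /=; rewrite mxE in_itv /=; exact: cu.
have hs k : exists i, (k <= i)%N /\ `|v^T - u i| <= k.+1%:R^-1.
  have [||w [[i ki <-] wv]] := clv [set (u i)^T | i in [set i | (k <= i)%N]]
      (ball v (k.+1%:R^-1 : R)).
  - by exists k => // i /= ki; exists i.
  - by apply: nbhsx_ballx; rewrite invr_gt0.
  exists i; split => //; move: wv; rewrite mx_norm_ball /ball_ /= => wv.
  apply: norm_le_coord; first by rewrite invr_ge0.
  move=> p r; apply: le_trans (ltW wv).
  by have := coord_le_norm (v - (u i)^T) r p; rewrite !mxE.
have [s hs'] := choice hs; exists v^T, s; split.
- by move=> i; rewrite mxE; have := Av i; rewrite /= in_itv.
- by move=> k; have [] := hs' k.
- by move=> k; have [] := hs' k.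
Qed.

End subsequences.

(** The cocycle identity, behind both subadditivity and the splitting of a product at time [l]. *)
Lemma layer_prodD (M : Type) (R : realType) (N : nat) (L : M -> M)
    (T : M -> 'cV[R]_N -> 'cV[R]_N) (n k : nat) (m : M) :
  layer_prod L T (n + k) m =
  layer_prod L T k (iter n L m) \o layer_prod L T n m.
Proof.
elim: k => [|k ih]; first by rewrite addn0.
by rewrite addnS /= ih -iterD addnC.
Qed.

Theorem theorem6 (R : realType) (N : nat) (N_ge1 : (1 <= N)%N)
    (nrm : 'cV[R]_N -> R) (nrm_norm : is_norm nrm)
    (disp : measure_display) (M : measurableType disp) (mu : probability M R)
    (L : M -> M) (W : M -> 'M[R]_N) (b : M -> 'cV[R]_N)
    (W_unit : forall m, W m \in unitmx)
    (T_stat : stationary nrm mu L (fun m => tanh_layer (W m) (b m))) :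
  let P := layer_prod L (fun m => tanh_layer (W m) (b m)) in
  exists lambda : R,
    {ae mu, forall m,
      (fun n : nat =>
         (sup [set nrm (P n m z.1 - P n m z.2) / nrm (z.1 - z.2)
              | z in offdiag R N]) `^ (n%:R^-1)) @ \oo --> expR lambda} /\
    (0 < lambda ->
     {ae mu, forall m,
       exists (x : 'cV[R]_N) (z : nat -> 'cV[R]_N * 'cV[R]_N),
         [/\ cube R N x,
             forall i, offdiag R N (z i),
             z @ \oo --> (x, x) &
             forall eps : R, 0 < eps ->
               exists N0 : nat, forall n : nat, (N0 < n)%N ->
                 \forall i \near \oo,
                   expR ((lambda - eps) * n%:R)
                   <= nrm (P n m (z i).1 - P n m (z i).2)
                      / nrm ((z i).1 - (z i).2)]}).
Proof.
move=> P; have [L_mp L_erg _ D_meas D_int] := T_stat.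
pose T m := tanh_layer (W m) (b m).
pose d0 (x y : 'cV[R]_N) := nrm (x - y).
have d0E : (fun x y => 1 * nrm (x - y)) = d0.
  by apply/funext => x; apply/funext => y; rewrite mul1r.
have d0_metric : metrics nrm d0 by rewrite -d0E; exact: metrics_scaled_norm.
have bT m : bilipschitz nrm (T m) by exact: bilipschitz_tanh_layer.
have bP n m : bilipschitz nrm (P n m).
  by elim: n => [|n ih]; [exact: bilipschitz_id|exact: (bilipschitz_comp (bT (iter n L m)) ih)].
pose a n m := logLip nrm (P n m).
pose q m := distortion nrm (T m).
have D_le n m : distortion nrm (P n m) <= \sum_(i < n) q (iter i L m).
  elim: n => [|n ih]; first by rewrite big_ord0; exact: distortion_id.
  rewrite big_ord_recr /=; apply: le_trans (lerD ih (lexx _)).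
  exact: (distortion_comp N_ge1 nrm_norm (bP n m) (bT (iter n L m))).
have a_le n m : `|a n m| <= \sum_(i < n) q (iter i L m).
  exact: le_trans (logLip_le_distortion N_ge1 nrm_norm (bP n m)) (D_le n m).
have a_sub n k m : a (n + k)%N m <= a n m + a k (iter n L m).
  rewrite /a /P layer_prodD.
  exact: (logLip_comp N_ge1 nrm_norm (bP n m) (bP k (iter n L m))).
have a_meas n : measurable_fun setT (a n).
  apply: measurable_fun_cvg => [j|m _]; last first.
    exact: (logLip_Dmetric_cvg N_ge1 nrm_norm (bP n m)).
  apply: measurable_funD; last exact: measurable_cst.
  by apply: D_meas => //; apply: metrics_scaled_norm; rewrite ?invr_gt0.
have q_int : mu.-integrable setT (EFin \o q).
  have qE m : q m = Dmetric (pullback_dist (T m) d0) d0.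
    by rewrite (Dmetric_norm N_ge1 nrm_norm (bT m)).
  apply/integrableP; split.
    apply/measurable_EFinP; rewrite (funext qE).
    exact: (D_meas d0 d0 1%N d0_metric d0_metric).
  apply: le_lt_trans (D_int d0 d0_metric); rewrite le_eqVlt; apply/orP; left.
  apply/eqP; apply: eq_integral => m _ /=; rewrite ger0_norm ?qE//.
  by rewrite -qE (le_trans _ (logLip_le_distortion N_ge1 nrm_norm (bT m))).
have [lambda [cocycle_cvg good_times]] := subadditive_ergodic L_mp L_erg a_meas q_int a_le a_sub.
exists lambda; split.
  apply: filterS cocycle_cvg => m am.
  have Lip0 n := Lip_gt0 N_ge1 nrm_norm (bP n m).
  (* This also holds at [n = 0], where the inverse of [0] is [0] and both sides equal [1]. *)
  have -> : (fun n : nat => (sup [set nrm (P n m z.1 - P n m z.2) / nrm (z.1 - z.2)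
      | z in offdiag R N]) `^ (n%:R^-1)) = (fun n : nat => expR (a n m / n%:R)).
    apply/funext => n; rewrite -/(Lip nrm (P n m)) /powR gt_eqF//.
    by rewrite mulrC.
  by apply: continuous_cvg am; exact: continuous_expR.
move=> lambda0; apply: filterS good_times => m [kk hkk].
have Lip0 n m' := Lip_gt0 N_ge1 nrm_norm (bP n m').
(* Good times [ni i >= i], with thresholds [kk j] that do not depend on [i]. *)
have [ni hni] := choice (fun i => let: ex_intro2 n h1 h2 := hkk i in
  ex_intro (fun n => (i <= n)%N /\ forall j l, (kk j <= l <= n)%N ->
      (lambda - j.+1%:R^-1) * l%:R <= a n m - a (n - l)%N (iter l L m)) n (conj h1 h2)).
(* The supremum need not be attained, so a pair within a factor [expR (-1)] of it is taken. *)
have : forall i, exists z, offdiag R N z /\ expR (-1) * Lip nrm (P (ni i) m) <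
    nrm (P (ni i) m z.1 - P (ni i) m z.2) / nrm (z.1 - z.2).
  move=> i; have [|z oz hz] := Lip_approx N_ge1 nrm_norm (bP (ni i) m)
    (t := expR (-1) * Lip nrm (P (ni i) m)).
    by rewrite gtr_pMl// expR_lt1 oppr_lt0.
  by exists z.
move=> /choice[z' hz'].
(* The last [ni i - l] maps expand by at most their Lipschitz constant, so the first [l] must supply
   the rest. The [- 1] in the exponent is the loss in the choice of [z']. *)
have expansion i j l : (kk j <= l <= ni i)%N ->
    expR ((lambda - j.+1%:R^-1) * l%:R - 1) <=
    nrm (P l m (z' i).1 - P l m (z' i).2) / nrm ((z' i).1 - (z' i).2).
  move=> /[dup] /andP[_ lni] /(proj2 (hni i)) h.
  have [oz hz] := hz' i.
  have z0 := offdiag_gt0 nrm_norm oz.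
  have olz := bilipschitz_offdiag nrm_norm (bP l m) oz.
  have lz0 := offdiag_gt0 nrm_norm olz.
  set p := (ni i - l)%N in h; have pE : ni i = (l + p)%N by rewrite subnKC.
  have := ratio_le_Lip N_ge1 nrm_norm (bP p (iter l L m)) olz.
  rewrite ler_pdivrMr//= => hp.
  have : expR (-1) * Lip nrm (P (ni i) m) <= Lip nrm (P p (iter l L m)) *
     (nrm (P l m (z' i).1 - P l m (z' i).2) / nrm ((z' i).1 - (z' i).2)).
    apply: (le_trans (ltW hz)); rewrite mulrA ler_pM2r ?invr_gt0//.
    by rewrite {1 2}pE /P layer_prodD.
  rewrite mulrC -ler_pdivrMl// => hq; apply: le_trans hq.
  apply: (@le_trans _ _ (expR (a (ni i) m - a p (iter l L m) - 1))).
    by rewrite ler_expR lerB.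
  rewrite !expRD expRN !lnK ?posrE//.
  by rewrite le_eqVlt; apply/orP; left; apply/eqP; ring.
(* Half of [eps] covers [1 / (j + 1)]; the other half absorbs the [- 1] once [n > j]. *)
have rate eps : 0 < eps -> exists N0 : nat, forall n, (N0 < n)%N -> forall i,
    (n <= i)%N -> expR ((lambda - eps) * n%:R) <=
    nrm (P n m (z' i).1 - P n m (z' i).2) / nrm ((z' i).1 - (z' i).2).
  move=> eps0; pose j := Num.truncn (2 / eps).
  have je : j.+1%:R^-1 <= eps / 2.
    by rewrite -[leRHS]invrK lef_pV2 ?posrE ?invr_gt0 ?divr_gt0// invf_div ltW// truncnS_gt.
  exists (maxn (kk j) j) => n; rewrite gtn_max => /andP[kn jn] i ni'.
  have h : (kk j <= n <= ni i)%N.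
    by rewrite (ltnW kn) (leq_trans ni' (proj1 (hni i))).
  apply: le_trans (expansion i j n h); rewrite ler_expR.
  have n1 : 1 <= eps / 2 * n%:R.
    rewrite -ler_pdivrMl ?divr_gt0// mulr1 invf_div.
    by apply: le_trans (ltW (truncnS_gt _)) _; rewrite ler_nat.
  have : j.+1%:R^-1 * n%:R <= eps / 2 * n%:R by rewrite ler_wpM2r.
  by move: (j.+1%:R^-1) je n1 => t ? ? ?; rewrite !mulrBl; lra.
have oz' i : offdiag R N (z' i) by have [] := hz' i.
have cz' i : cube R N (z' i).1 by have [] := oz' i.
have [x [s [cx sk xs]]] := cube_subsequence cz'.
have [C C0 hC] := nrm_le_norm nrm_norm; have [C' C'0 hC'] := norm_le_nrm nrm_norm.
(* With [eps = lambda / 2] the pairs still expand exponentially. *)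
have l20 : 0 < lambda / 2 by rewrite divr_gt0.
have [N0 hN0] := rate _ l20.
(* The images after [i] steps stay in the cube, at [nrm]-distance at most [C * 2], so the initial
   pair must be close. The crude bound [t <= expR t] gives a rate [1 / i], enough for
   convergence. *)
have dist i : (N0 < i)%N -> `|(z' i).1 - (z' i).2| <= C' * (C * 2) / (lambda / 2) / i%:R.
  move=> Ni; have := hN0 i Ni i (leqnn i).
  have z0 := offdiag_gt0 nrm_norm (oz' i).
  have i0 : 0 < i%:R :> R by rewrite ltr0n (leq_ltn_trans _ Ni).
  have -> : lambda - lambda / 2 = lambda / 2 by lra.
  rewrite ler_pdivlMr// => h.
  have [Pc _] := bP i m; have [c1 c2 _] := oz' i.
  have h2 : nrm (P i m (z' i).1 - P i m (z' i).2) <= C * 2.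
    apply: (le_trans (hC _)); rewrite ler_pM2l//; apply: le_trans (ler_normB _ _) _.
    have := cube_norm_le1 (Pc _ c1); have := cube_norm_le1 (Pc _ c2); lra.
  have h3 : lambda / 2 * i%:R <= expR (lambda / 2 * i%:R).
    by have := expR_ge1Dx (lambda / 2 * i%:R); lra.
  apply: (le_trans (hC' _)); rewrite -!mulrA ler_pM2l// !mulrA.
  rewrite -mulrA -invfM ler_pdivlMr ?mulr_gt0// mulrC.
  by apply: le_trans (le_trans h h2); rewrite ler_pM2r.
exists x, (z' \o s); split => //.
- move=> i; exact: oz'.
- rewrite (_ : z' \o s = fun k => ((z' (s k)).1, (z' (s k)).2)); last first.
    by apply/funext => k /=; case: (z' (s k)).
  have c1 : (fun k => (z' (s k)).1) @ \oo --> x.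
    by apply: (@cvg_of_bound _ _ _ _ 1); apply: nearW => k; rewrite mul1r; exact: xs.
  suff c2 : (fun k => (z' (s k)).2) @ \oo --> x by exact: (cvg_pair c1 c2).
  (* The [1] accounts for the first components, and the final [2] for [1 / s k <= 2 / (k + 1)],
     valid as [s k >= k >= 1]. *)
  apply: (@cvg_of_bound _ _ _ _ (1 + C' * (C * 2) / (lambda / 2) * 2)).
  exists N0.+1 => // k /= Nk; have Ns : (N0 < s k)%N by exact: leq_trans Nk (sk k).
  have -> : x - (z' (s k)).2 = (x - (z' (s k)).1) + ((z' (s k)).1 - (z' (s k)).2).
    by rewrite addrA subrK.
  apply: le_trans (ler_normD _ _) _; rewrite mulrDl mul1r; apply: lerD => //.
  apply: (le_trans (dist _ Ns)); rewrite -[leRHS]mulrA ler_wpM2l//; first last.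
    have k0 : (0 < k)%N by exact: leq_ltn_trans Nk.
    have s0 : (0 < s k)%N by exact: leq_trans (sk k).
    rewrite ler_pdivlMr// mulrC ler_pdivrMr ?ltr0n// -natrM ler_nat.
    by rewrite mul2n -addnn -addn1 leq_add.
  by apply: divr_ge0; [apply: ltW; rewrite !mulr_gt0|exact: ltW].
(* The rate holds for every index from [n] on, hence along [s], since [s i >= i]. *)
- move=> eps /rate[N1 hN1]; exists N1 => n nN1.
  by exists n => // i /= ni'; apply: hN1 => //; exact: leq_trans ni' (sk i).
Qed.
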